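(* The Fixed MCR (Maximum Cover under Rotation) problem is 3SUM-hard. Here the Fixed MCR problem is: given a point $r$, a simple polygon $P$, and a finite point set $S$ in the plane, compute an angle $\theta\in[0,2\pi)$ such that, after rotating $P$ clockwise around $r$ by $\theta$, the number of points of $S$ contained in $P$ is maximized.
   Context: The 3SUM problem: given a set of $N$ numbers, decide whether it contains three elements whose sum is $0$. A problem $\Pi$ is called 3SUM-hard if every instance of 3SUM of size $N$ can be solved by solving a constant number of instances of $\Pi$ of size $O(N)$, plus $o(N^2)$ additional time; consequently a subquadratic algorithm for $\Pi$ would yield a subquadratic algorithm for 3SUM. The size of a Fixed MCR instance is $n+m$, where $n=|S|$ and $m$ is the number of vertices of $P$. A simple polygon $P$ is understood as the closed planar region bounded by it. The model of computation is the usual real-RAM model of computational geometry (exact real arithmetic and elementary geometric operations at unit cost). *)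

(* Defs.v *)
From Stdlib Require Import Reals List Arith ClassicalEpsilon.
Import ListNotations.
Open Scope R_scope.

(** * Plane geometry *)

Definition point := (R * R)%type.

Definition on_segment (p q x : point) : Prop :=
  exists t, 0 <= t <= 1 /\
    x = ((1 - t) * fst p + t * fst q, (1 - t) * snd p + t * snd q).

(** A polygon is the cyclic list of its vertices; edge [i] joins vertex [i] to
    vertex [i + 1] modulo the number of vertices. *)
Definition polygon := list point.

Definition vertex (P : polygon) (i : nat) : point := nth i P (0, 0).

Definition on_edge (P : polygon) (i : nat) (x : point) : Prop :=
  on_segment (vertex P i) (vertex P (S i mod length P)) x.

Definition on_boundary (P : polygon) (x : point) : Prop :=
  exists i, (i < length P)%nat /\ on_edge P i x.

(** Two edges meet only when they are cyclically consecutive, and then only at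
    their common vertex. *)
Definition simple_polygon (P : polygon) : Prop :=
  (3 <= length P)%nat /\ NoDup P /\
  forall i j x, (i < j < length P)%nat -> on_edge P i x -> on_edge P j x ->
    (j = S i /\ x = vertex P j) \/
    (i = 0%nat /\ S j = length P /\ x = vertex P 0).

Definition joined_avoiding (B : point -> Prop) (p q : point) : Prop :=
  exists gx gy : R -> R,
    continuity gx /\ continuity gy /\
    (gx 0, gy 0) = p /\ (gx 1, gy 1) = q /\
    forall t, 0 <= t <= 1 -> ~ B (gx t, gy t).

(** The bounded components of the complement of the boundary. Components and
    path components agree, the complement being open in the plane. *)
Definition in_interior (P : polygon) (p : point) : Prop :=
  ~ on_boundary P p /\
  exists M, forall q, joined_avoiding (on_boundary P) p q ->
    Rabs (fst q) <= M /\ Rabs (snd q) <= M.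

Definition in_polygon (P : polygon) (p : point) : Prop :=
  on_boundary P p \/ in_interior P p.

Definition rotate_cw (r : point) (theta : R) (p : point) : point :=
  let x := fst p - fst r in
  let y := snd p - snd r in
  (fst r + (x * cos theta + y * sin theta),
   snd r + (y * cos theta - x * sin theta)).

Definition in_rotated (r : point) (P : polygon) (theta : R) (s : point) : Prop :=
  exists p, in_polygon P p /\ s = rotate_cw r theta p.

Definition cover (r : point) (P : polygon) (S : list point) (theta : R) : nat :=
  length (filter
    (fun s => if excluded_middle_informative (in_rotated r P theta s)
              then true else false) S).

(** * Computational problems *)

(** [encode] is the form in which a real RAM reads an instance, and answers
    are sequences of reals; [answers i l] means that [l] is a correct answer
    to [i], of which there may be several. *)
Record problem := Problem {
  instance : Type;
  size : instance -> nat;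
  encode : instance -> list R;
  answers : instance -> list R -> Prop }.

Record three_sum_instance := ThreeSumInstance {
  numbers : list R;
  numbers_distinct : NoDup numbers }.

Definition has_zero_triple (X : list R) : Prop :=
  exists a b c, In a X /\ In b X /\ In c X /\
    a <> b /\ a <> c /\ b <> c /\ a + b + c = 0.

Definition three_sum : problem := {|
  instance := three_sum_instance;
  size X := length (numbers X);
  encode X := numbers X;
  answers X out :=
    (has_zero_triple (numbers X) /\ out = [1]) \/
    (~ has_zero_triple (numbers X) /\ out = [0]) |}.

Record mcr_instance := MCRInstance {
  center : point;
  region : polygon;
  points : list point;
  region_simple : simple_polygon region;
  points_distinct : NoDup points }.

Definition fixed_mcr : problem := {|
  instance := mcr_instance;
  size I := (length (points I) + length (region I))%nat;
  encode I :=
    INR (length (region I)) :: INR (length (points I)) ::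
    fst (center I) :: snd (center I) ::
    flat_map (fun p => [fst p; snd p]) (region I ++ points I);
  answers I out :=
    exists theta, out = [theta] /\ 0 <= theta < 2 * PI /\
      forall phi, 0 <= phi < 2 * PI ->
        (cover (center I) (region I) (points I) phi <=
         cover (center I) (region I) (points I) theta)%nat |}.

(** * The real RAM *)

(** Programs use natural-number and real registers, and natural-number and real
    arrays, all designated by number. A program text mentions only finitely
    many of them; the arrays are unbounded and indexed by computed values. *)

Inductive iexp : Type :=
| i_const (n : nat)
| i_var (x : nat)
| i_get (a : nat) (e : iexp)
| i_add (e f : iexp)
| i_sub (e f : iexp).

Inductive rexp : Type :=
| r_nat (e : iexp)
| r_pi
| r_var (x : nat)
| r_get (a : nat) (e : iexp)
| r_add (e f : rexp)
| r_sub (e f : rexp)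
| r_mul (e f : rexp)
| r_div (e f : rexp)
| r_sqrt (e : rexp)
| r_sin (e : rexp)
| r_cos (e : rexp)
| r_atan (e : rexp).

Inductive bexp : Type :=
| b_ltn (e f : iexp)
| b_ltr (e f : rexp)
| b_not (b : bexp)
| b_and (b c : bexp).

Inductive cmd : Type :=
| c_skip
| c_iset (x : nat) (e : iexp)
| c_rset (x : nat) (e : rexp)
| c_iput (a : nat) (e : iexp) (v : iexp)
| c_rput (a : nat) (e : iexp) (v : rexp)
| c_seq (c d : cmd)
| c_if (b : bexp) (c d : cmd)
| c_while (b : bexp) (c : cmd)
| c_call (a x : nat).

Record state := State {
  ireg : nat -> nat;
  rreg : nat -> R;
  iarr : nat -> nat -> nat;
  rarr : nat -> nat -> R }.

Definition upd {A : Type} (f : nat -> A) (k : nat) (v : A) : nat -> A :=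
  fun j => if Nat.eqb j k then v else f j.

Definition set_ireg (s : state) (x n : nat) : state :=
  State (upd (ireg s) x n) (rreg s) (iarr s) (rarr s).

Definition set_rreg (s : state) (x : nat) (v : R) : state :=
  State (ireg s) (upd (rreg s) x v) (iarr s) (rarr s).

Definition set_iarr (s : state) (a i n : nat) : state :=
  State (ireg s) (rreg s) (upd (iarr s) a (upd (iarr s a) i n)) (rarr s).

Definition set_rarr (s : state) (a i : nat) (v : R) : state :=
  State (ireg s) (rreg s) (iarr s) (upd (rarr s) a (upd (rarr s a) i v)).

(** Sequences of reals are passed in an array [a] together with a register [x]
    that holds their length. *)
Definition fetch (s : state) (a x : nat) : list R :=
  map (rarr s a) (seq 0 (ireg s x)).

Definition store (s : state) (a x : nat) (l : list R) : state :=
  State (upd (ireg s) x (length l)) (rreg s) (iarr s)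
        (upd (rarr s) a (fun i => nth i l (rarr s a i))).

Fixpoint ieval (s : state) (e : iexp) : nat :=
  match e with
  | i_const n => n
  | i_var x => ireg s x
  | i_get a e => iarr s a (ieval s e)
  | i_add e f => ieval s e + ieval s f
  | i_sub e f => ieval s e - ieval s f
  end.

Definition lift1 {A B : Type} (f : A -> option B) (u : option A) : option B :=
  match u with Some x => f x | None => None end.

Definition lift2 {A B : Type} (f : A -> A -> option B) (u v : option A)
  : option B :=
  lift1 (fun x => lift1 (f x) v) u.

Definition div_op (x y : R) : option R :=
  if Req_dec_T y 0 then None else Some (x / y).

Definition sqrt_op (x : R) : option R :=
  if Rle_dec 0 x then Some (sqrt x) else None.

(** Sine and cosine are available for angles in [[0, 2 PI]] only: on unbounded
    arguments they would allow rounding in constant time, which a real RAM must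
    not do. *)
Definition angle_op (f : R -> R) (x : R) : option R :=
  if Rle_dec 0 x then
    if Rle_dec x (2 * PI) then Some (f x) else None
  else None.

Fixpoint reval (s : state) (e : rexp) : option R :=
  match e with
  | r_nat e => Some (INR (ieval s e))
  | r_pi => Some PI
  | r_var x => Some (rreg s x)
  | r_get a e => Some (rarr s a (ieval s e))
  | r_add e f => lift2 (fun x y => Some (x + y)) (reval s e) (reval s f)
  | r_sub e f => lift2 (fun x y => Some (x - y)) (reval s e) (reval s f)
  | r_mul e f => lift2 (fun x y => Some (x * y)) (reval s e) (reval s f)
  | r_div e f => lift2 div_op (reval s e) (reval s f)
  | r_sqrt e => lift1 sqrt_op (reval s e)
  | r_sin e => lift1 (angle_op sin) (reval s e)
  | r_cos e => lift1 (angle_op cos) (reval s e)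
  | r_atan e => lift1 (fun x => Some (atan x)) (reval s e)
  end.

Fixpoint beval (s : state) (b : bexp) : option bool :=
  match b with
  | b_ltn e f => Some (Nat.ltb (ieval s e) (ieval s f))
  | b_ltr e f =>
      lift2 (fun x y => Some (if Rlt_dec x y then true else false))
            (reval s e) (reval s f)
  | b_not b => lift1 (fun u => Some (negb u)) (beval s b)
  | b_and b c => lift2 (fun u v => Some (andb u v)) (beval s b) (beval s c)
  end.

Fixpoint icost (e : iexp) : nat :=
  match e with
  | i_const _ | i_var _ => 1
  | i_get _ e => 1 + icost e
  | i_add e f | i_sub e f => 1 + icost e + icost f
  end.

Fixpoint rcost (e : rexp) : nat :=
  match e with
  | r_pi | r_var _ => 1
  | r_nat e | r_get _ e => 1 + icost e
  | r_add e f | r_sub e f | r_mul e f | r_div e f => 1 + rcost e + rcost f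
  | r_sqrt e | r_sin e | r_cos e | r_atan e => 1 + rcost e
  end.

Fixpoint bcost (b : bexp) : nat :=
  match b with
  | b_ltn e f => 1 + icost e + icost f
  | b_ltr e f => 1 + rcost e + rcost f
  | b_not b => 1 + bcost b
  | b_and b c => 1 + bcost b + bcost c
  end.

(** [exec O c s s' t calls]: with oracle [O], command [c] started in [s] halts
    in [s'] after [t] unit-cost operations, having consulted the oracle on the
    inputs [calls], in this order. A command that evaluates an undefined
    expression does not halt. *)
Inductive exec (O : list R -> list R)
  : cmd -> state -> state -> nat -> list (list R) -> Prop :=
| exec_skip s : exec O c_skip s s 1 []
| exec_iset s x e :
    exec O (c_iset x e) s (set_ireg s x (ieval s e)) (1 + icost e) []
| exec_rset s x e v :
    reval s e = Some v ->
    exec O (c_rset x e) s (set_rreg s x v) (1 + rcost e) []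
| exec_iput s a e f :
    exec O (c_iput a e f) s (set_iarr s a (ieval s e) (ieval s f))
         (1 + icost e + icost f) []
| exec_rput s a e f v :
    reval s f = Some v ->
    exec O (c_rput a e f) s (set_rarr s a (ieval s e) v)
         (1 + icost e + rcost f) []
| exec_seq s s' s'' c d t u l k :
    exec O c s s' t l -> exec O d s' s'' u k ->
    exec O (c_seq c d) s s'' (t + u) (l ++ k)
| exec_if_true s s' b c d t l :
    beval s b = Some true -> exec O c s s' t l ->
    exec O (c_if b c d) s s' (1 + bcost b + t) l
| exec_if_false s s' b c d t l :
    beval s b = Some false -> exec O d s s' t l ->
    exec O (c_if b c d) s s' (1 + bcost b + t) l
| exec_while_false s b c :
    beval s b = Some false ->
    exec O (c_while b c) s s (1 + bcost b) []
| exec_while_true s s' s'' b c t u l k :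
    beval s b = Some true -> exec O c s s' t l ->
    exec O (c_while b c) s' s'' u k ->
    exec O (c_while b c) s s'' (1 + bcost b + t + u) (l ++ k)
| exec_call s a x :
    exec O (c_call a x) s (store s a x (O (fetch s a x))) 1 [fetch s a x].

Definition blank : state :=
  State (fun _ => 0%nat) (fun _ => 0) (fun _ _ => 0%nat) (fun _ _ => 0).

(** Input and output are both passed in real array 0 and register 0. *)
Definition run (O : list R -> list R) (prog : cmd) (input output : list R)
    (t : nat) (calls : list (list R)) : Prop :=
  exists s, exec O prog (store blank 0 0 input) s t calls /\
            output = fetch s 0 0.

(** * 3SUM-hardness *)

Definition solver (Pi : problem) (O : list R -> list R) : Prop :=
  forall i : instance Pi, answers Pi i (O (encode Pi i)).

Definition subquadratic (T : nat -> nat) : Prop :=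
  forall eps, 0 < eps -> exists N0, forall N, (N0 <= N)%nat ->
    INR (T N) <= eps * INR N ^ 2.

(** The bounds [k] on the number of calls, [C] on the instance sizes and [T] on
    the additional time hold uniformly, whatever solver of [Pi] is called. *)
Definition three_sum_hard (Pi : problem) : Prop :=
  exists (prog : cmd) (k C : nat) (T : nat -> nat),
    subquadratic T /\
    forall O, solver Pi O -> forall X : instance three_sum,
      let N := size three_sum X in
      exists output t calls,
        run O prog (encode three_sum X) output t calls /\
        answers three_sum X output /\
        (t <= T N)%nat /\
        (length calls <= k)%nat /\
        Forall (fun l => exists i : instance Pi,
                  l = encode Pi i /\ (size Pi i <= C * (N + 1))%nat) calls.

(* Main.v *)
Require Import Defs.
From Stdlib Require Import Reals List Arith Psatz Sorted ClassicalEpsilon.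
Import ListNotations.
Open Scope R_scope.

(** The region is a convex polygon inscribed in the unit circle around [r]. A
    point of the circle is covered exactly when it is rotated onto a vertex, so
    that on the circle coverage counts exact coincidences. Every number [c] of the
    3SUM instance gives a pair of vertices at angles [t] and [t + w], and the chord
    from angle [0] to angle [w] carries [2 W] points, half of them close to either
    end. If the rotated chord is not one of the edges of length [w], then all
    the points near one of its ends lie outside the polygon; hence a rotation that
    aligns the chord with an edge gains [W] points over all others, and the
    optimal angle selects some [c]. The [W] other points sit on the circle at
    angles encoding [a], and vertices encoding [- b] make the [a]-point hit the
    [b]-vertex under the rotation selecting [c] exactly when [a + b + c = 0].
    Every [a] and [b] being represented twice, there are at least four coincidences
    for some [c] if a solution exists, and at most two for every [c] otherwise; a
    dummy angle with exactly three coincidences is therefore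
    optimal exactly when there is no solution. All proofs that a point is covered
    put it on the boundary, and all proofs that it is not separate it from the
    polygon by a line, so that no form of the Jordan curve theorem is needed.

    Listing the vertices requires sorting, which is done in time [N ^ (3/2)] by
    repeatedly selecting the successor of the last number found, while the
    successors within blocks of length about [sqrt N] are kept in a table. *)

(** * Directions, half-angle sines and separation by half-planes *)

Definition dir (a : R) : point := (cos a, sin a).

Definition dot (n p : point) : R := fst n * fst p + snd n * snd p.

Definition lerp (p q : point) (t : R) : point :=
  ((1 - t) * fst p + t * fst q, (1 - t) * snd p + t * snd q).

Definition rotate_ccw (theta : R) (p : point) : point :=
  (fst p * cos theta - snd p * sin theta, fst p * sin theta + snd p * cos theta).

Lemma dot_lerp n p q t : dot n (lerp p q t) = (1 - t) * dot n p + t * dot n q.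
Proof. unfold dot, lerp; simpl; ring. Qed.

Lemma dot_dir a b : dot (dir a) (dir b) = cos (b - a).
Proof. unfold dot, dir; simpl; rewrite cos_minus; ring. Qed.

(** The line through [dir p] and [dir q] (the tangent if [p = q]) has normal [dir ((p + q) / 2)] and
    offset [cos ((q - p) / 2)]. The sign of the product of sines therefore tells on which side of it
    [dir v] lies, and the separation arguments on the circle reduce to this sign. *)
Lemma dot_dir_mid p q v :
  dot (dir ((p + q) / 2)) (dir v) =
  cos ((q - p) / 2) - 2 * (sin ((v - p) / 2) * sin ((v - q) / 2)).
Proof.
  rewrite dot_dir.
  replace (v - (p + q) / 2) with ((v - p) / 2 + (v - q) / 2) by field.
  replace ((q - p) / 2) with ((v - p) / 2 - (v - q) / 2) by field.
  rewrite cos_plus, cos_minus; ring.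
Qed.

Lemma sin_half_neg x : -2 * PI < x < 0 -> sin (x / 2) < 0.
Proof.
  intros H. replace (x / 2) with (- (- x / 2)) by field.
  rewrite sin_neg. assert (0 < sin (- x / 2)) by (apply sin_gt_0; lra). lra.
Qed.

Lemma sin_half_pos x : 0 < x < 2 * PI -> 0 < sin (x / 2).
Proof. intros H. apply sin_gt_0; lra. Qed.

Lemma sin_half_prod_pos x y :
  -2 * PI < x < 2 * PI -> -2 * PI < y < 2 * PI -> 0 < x * y ->
  0 < sin (x / 2) * sin (y / 2).
Proof.
  intros Hx Hy Hxy.
  destruct (Rlt_dec 0 x) as [H|H].
  - assert (0 < y) by nra.
    apply Rmult_lt_0_compat; apply sin_half_pos; lra.
  - assert (x < 0) by nra. assert (y < 0) by nra.
    pose proof (sin_half_neg x). pose proof (sin_half_neg y). nra.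
Qed.

Lemma sin_half_prod_nonneg x y :
  -2 * PI < x < 2 * PI -> -2 * PI < y < 2 * PI ->
  (x <= 0 /\ y <= 0) \/ (0 <= x /\ 0 <= y) ->
  0 <= sin (x / 2) * sin (y / 2).
Proof.
  intros Hx Hy Hxy.
  destruct (Req_dec x 0) as [->|Hx0].
  { replace (0 / 2) with 0 by field. rewrite sin_0; lra. }
  destruct (Req_dec y 0) as [->|Hy0].
  { replace (0 / 2) with 0 by field. rewrite sin_0; lra. }
  apply Rlt_le, sin_half_prod_pos; try assumption.
  destruct Hxy; nra.
Qed.

Lemma pi_gt_3 : 3 < PI.
Proof. pose proof PI2_3_2; lra. Qed.

Lemma dir_inj a b : -2 * PI < a - b < 2 * PI -> dir a = dir b -> a = b.
Proof.
  intros Hab E.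
  assert (Hc : cos (a - b) = 1).
  { rewrite <- dot_dir, <- E. unfold dot, dir; simpl.
    pose proof (sin2_cos2 a); unfold Rsqr in *; lra. }
  destruct (Req_dec (a - b) 0) as [H|H]; [lra|].
  assert (0 < sin ((a - b) / 2) * sin ((a - b) / 2))
    by (apply sin_half_prod_pos; nra).
  assert (cos (a - b) = 1 - 2 * (sin ((a - b) / 2) * sin ((a - b) / 2))).
  { replace (a - b) with (2 * ((a - b) / 2)) at 1 by field.
    rewrite cos_2a_sin; ring. }
  lra.
Qed.

Lemma vertex_In (P : polygon) i : (i < length P)%nat -> In (vertex P i) P.
Proof. intros; apply nth_In; assumption. Qed.

Lemma in_polygon_vertex P v : In v P -> in_polygon P v.
Proof.
  intros H. left. destruct (In_nth _ _ (0, 0) H) as (i & Hi & E).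
  exists i; split; [assumption|]. exists 0; split; [lra|].
  change (vertex P i = v) in E. rewrite E. destruct v as [x y]; simpl. f_equal; ring.
Qed.

Lemma convex_lt a b c t : 0 <= t <= 1 -> a < c -> b < c -> (1 - t) * a + t * b < c.
Proof.
  intros Ht Ha Hb.
  assert (0 <= (1 - t) * (c - a)) by (apply Rmult_le_pos; lra).
  destruct (Req_dec t 0) as [->|H0]; [lra|].
  assert (0 < t * (c - b)) by (apply Rmult_lt_0_compat; lra). lra.
Qed.

(** The ray from [q] in direction [n] stays clear of the boundary and is unbounded, so [q] lies in
    no bounded component. *)
Lemma outside_half_plane P n q :
  0 < dot n n -> (forall v, In v P -> dot n v < dot n q) -> ~ in_polygon P q.
Proof.
  intros Hn HP.
  assert (HB : forall x, on_boundary P x -> dot n x < dot n q).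
  { intros x (i & Hi & t & Ht & ->).
    fold (lerp (vertex P i) (vertex P (S i mod length P)) t). rewrite dot_lerp.
    pose proof (HP _ (vertex_In P i Hi)) as H1.
    assert (H2 : dot n (vertex P (S i mod length P)) < dot n q)
      by (apply HP, vertex_In, Nat.mod_upper_bound; lia).
    apply convex_lt; assumption. }
  intros [Hb | [_ (M & HM)]]; [specialize (HB _ Hb); lra|].
  (* The numerator pushes [dot n] at the end of the path above
     [(Rabs (fst n) + Rabs (snd n)) * Rabs M], the most it can be when both coordinates are bounded
     by [M]. The sign of [M] is not known, hence [Rabs M]. *)
  set (c := ((Rabs (fst n) + Rabs (snd n)) * Rabs M + Rabs (dot n q) + 1) / dot n n).
  assert (Hc : 0 < c).
  { apply Rdiv_lt_0_compat; [|assumption].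
    pose proof (Rabs_pos (fst n)); pose proof (Rabs_pos (snd n));
    pose proof (Rabs_pos M); pose proof (Rabs_pos (dot n q)). nra. }
  destruct (HM (fst q + c * fst n, snd q + c * snd n)) as [H1 H2].
  - exists (fun t => fst q + t * (c * fst n)), (fun t => snd q + t * (c * snd n)).
    repeat split; try (intros t; reg).
    + destruct q; simpl; f_equal; ring.
    + f_equal; ring.
    + intros t Ht Hbt. specialize (HB _ Hbt).
      assert (E : dot n (fst q + t * (c * fst n), snd q + t * (c * snd n)) =
              dot n q + t * c * dot n n) by (unfold dot; simpl; ring).
      rewrite E in HB.
      assert (0 <= t * c * dot n n); [|lra].
      apply Rmult_le_pos; [|lra]. apply Rmult_le_pos; lra.
  - simpl in H1, H2.
    assert (E : fst n * (fst q + c * fst n) + snd n * (snd q + c * snd n) =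
            dot n q + c * dot n n) by (unfold dot; simpl; ring).
    assert (Ec : c * dot n n =
      (Rabs (fst n) + Rabs (snd n)) * Rabs M + Rabs (dot n q) + 1)
      by (unfold c; field; lra).
    rewrite Ec in E. clearbody c.
    pose proof (Rle_abs (fst n * (fst q + c * fst n))) as A1.
    pose proof (Rle_abs (snd n * (snd q + c * snd n))) as A2.
    rewrite Rabs_mult in A1, A2.
    pose proof (Rle_abs M). pose proof (Rle_abs (- dot n q)) as A3.
    rewrite Rabs_Ropp in A3.
    pose proof (Rabs_pos (fst n)); pose proof (Rabs_pos (snd n)).
    assert (Rabs (fst n) * Rabs (fst q + c * fst n) <= Rabs (fst n) * Rabs M)
      by (apply Rmult_le_compat_l; lra).
    assert (Rabs (snd n) * Rabs (snd q + c * snd n) <= Rabs (snd n) * Rabs M)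
      by (apply Rmult_le_compat_l; lra).
    lra.
Qed.

(** Counterclockwise rotation inverts the clockwise one, so the polygon can stay fixed while the
    points move. *)
Lemma in_rotated_origin P theta s :
  in_rotated (0, 0) P theta s <-> in_polygon P (rotate_ccw theta s).
Proof.
  pose proof (sin2_cos2 theta) as E; unfold Rsqr in E.
  split.
  - intros (p & Hp & ->). replace (rotate_ccw theta _) with p; [assumption|].
    destruct p as [x y]; unfold rotate_ccw, rotate_cw; simpl. f_equal.
    + transitivity (x * (sin theta * sin theta + cos theta * cos theta));
        [rewrite E|]; ring.
    + transitivity (y * (sin theta * sin theta + cos theta * cos theta));
        [rewrite E|]; ring.
  - intros H. exists (rotate_ccw theta s); split; [assumption|].
    destruct s as [x y]; unfold rotate_ccw, rotate_cw; simpl. f_equal.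
    + transitivity (x * (sin theta * sin theta + cos theta * cos theta));
        [rewrite E|]; ring.
    + transitivity (y * (sin theta * sin theta + cos theta * cos theta));
        [rewrite E|]; ring.
Qed.

Lemma rotate_ccw_dir theta a : rotate_ccw theta (dir a) = dir (a + theta).
Proof.
  unfold rotate_ccw, dir; simpl. rewrite cos_plus, sin_plus. f_equal; ring.
Qed.

Lemma rotate_ccw_lerp theta p q t :
  rotate_ccw theta (lerp p q t) = lerp (rotate_ccw theta p) (rotate_ccw theta q) t.
Proof. unfold rotate_ccw, lerp; simpl. f_equal; ring. Qed.

Lemma dot_dir_self a : dot (dir a) (dir a) = 1.
Proof. rewrite dot_dir, Rminus_diag, cos_0; reflexivity. Qed.

(** Here [sin (x + d) <= sin x + sin d <= sin x + sin (2 * x) <= 3 * sin x], and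
    [3 * s <= 3 / 5 < 4 / 5 <= 1 - s]. This is what makes a fifth of the chord at one end fall
    outside the polygon. *)
Lemma sin_weighted_lt x d s :
  0 < d -> d <= 2 * x -> x <= 1 / 2 -> 0 <= s -> s <= 1 / 5 ->
  s * sin (x + d) < (1 - s) * sin x.
Proof.
  intros Hd Hdx Hx Hs0 Hs. pose proof pi_gt_3.
  assert (0 < sin x) by (apply sin_gt_0; lra).
  assert (0 < sin d) by (apply sin_gt_0; lra).
  assert (sin d <= sin (2 * x)).
  { destruct (Req_dec d (2 * x)) as [->|]; [lra|].
    left; apply sin_increasing_1; lra. }
  rewrite sin_2a in H2. rewrite sin_plus.
  pose proof (COS_bound x). pose proof (COS_bound d).
  assert (sin x * cos d <= sin x) by nra.
  assert (cos x * sin d <= sin d).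
  { nra. }
  assert (sin x * cos x <= sin x) by nra.
  assert (sin x * cos d + cos x * sin d <= 3 * sin x) by lra.
  nra.
Qed.

(** * Convex polygons inscribed in the unit circle *)

Lemma StronglySorted_nth {R0 : R -> R -> Prop} V :
  StronglySorted R0 V -> forall i j, (i < j < length V)%nat ->
  R0 (nth i V 0) (nth j V 0).
Proof.
  induction 1 as [|a l Hs IH Hf]; simpl; intros i j Hij; [lia|].
  destruct j as [|j]; [lia|]. destruct i as [|i].
  - rewrite Forall_forall in Hf. apply Hf, nth_In; lia.
  - apply IH; lia.
Qed.

Lemma StronglySorted_apart (g : R) V :
  StronglySorted (fun u v => u + g <= v) V -> forall x y, In x V -> In y V ->
  x = y \/ x + g <= y \/ y + g <= x.
Proof.
  induction 1 as [|a l Hs IH Hf]; simpl; [tauto|].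
  rewrite Forall_forall in Hf.
  intros x y [<-|Hx] [<-|Hy]; auto.
Qed.

Lemma StronglySorted_app {A} (R0 : A -> A -> Prop) l m :
  StronglySorted R0 l -> StronglySorted R0 m ->
  (forall x y, In x l -> In y m -> R0 x y) -> StronglySorted R0 (l ++ m).
Proof.
  induction 1 as [|a l Hs IH Hf]; simpl; intros Hm H; [assumption|].
  constructor.
  - apply IH; auto.
  - rewrite Forall_forall in *. intros x Hx. apply in_app_iff in Hx as [Hx|Hx]; auto.
Qed.

Lemma StronglySorted_weaken (R1 R2 : R -> R -> Prop) l :
  (forall x y, R1 x y -> R2 x y) -> StronglySorted R1 l -> StronglySorted R2 l.
Proof.
  intros H. induction 1 as [|a l Hs IH Hf]; constructor; [assumption|].
  eapply Forall_impl; [|exact Hf]. auto.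
Qed.

Lemma StronglySorted_NoDup (g : R) V :
  0 < g -> StronglySorted (fun u v => u + g <= v) V -> NoDup V.
Proof.
  intros Hg. induction 1 as [|a l Hs IH Hf]; constructor; [|assumption].
  intros Ha. rewrite Forall_forall in Hf. specialize (Hf _ Ha). lra.
Qed.

Section Inscribed.

Variables (V : list R) (w : R).
Hypothesis w_pos : 0 < w.
Hypothesis V_sorted : StronglySorted (fun u v => u + w <= v) V.
(** The interval lies strictly inside one turn, with a margin on both sides of the angle 0, so that
    no angle ever has to be reduced modulo [2 * PI]. *)
Hypothesis V_range : forall v, In v V -> 1 <= v <= 4.

Lemma vertex_map_dir i : (i < length V)%nat -> vertex (map dir V) i = dir (nth i V 0).
Proof.
  intros H. unfold vertex. rewrite (nth_indep _ _ (dir 0)) by (rewrite length_map; lia).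
  apply map_nth.
Qed.

(** All vertices other than the two ends of edge [i] lie strictly on one side of its line. Since
    [i < j], edge [i] is never the closing one; edge [j] can touch its line only in a vertex that
    both edges share. *)
Lemma inscribed_simple : (3 <= length V)%nat -> simple_polygon (map dir V).
Proof.
  intros H3. pose proof pi_gt_3 as Hpi.
  split; [rewrite length_map; assumption|]. split.
  - apply NoDup_map_NoDup_ForallPairs.
    + intros a b Ha Hb E. apply V_range in Ha, Hb. apply dir_inj; [lra|assumption].
    + exact (StronglySorted_NoDup _ _ w_pos V_sorted).
  - intros i j x Hij. rewrite length_map in Hij.
    intros (t & Ht & Ex) (u & Hu & Ey). rewrite length_map in Ex, Ey.
    fold (lerp (vertex (map dir V) i) (vertex (map dir V) (S i mod length V)) t) in Ex.
    fold (lerp (vertex (map dir V) j) (vertex (map dir V) (S j mod length V)) u) in Ey.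
    rewrite (Nat.mod_small (S i)) in Ex by lia.
    assert (Hm : (S j mod length V < length V)%nat) by (apply Nat.mod_upper_bound; lia).
    assert (Hm' : (S j < length V /\ S j mod length V = S j)%nat \/
                  (S j = length V /\ S j mod length V = 0)%nat).
    { destruct (Nat.eq_dec (S j) (length V)) as [E|E].
      - right; split; [assumption|]. rewrite E; apply Nat.Div0.mod_same.
      - left; split; [lia|]. apply Nat.mod_small; lia. }
    set (m := (S j mod length V)%nat) in *. clearbody m.
    rewrite !vertex_map_dir in Ex, Ey by lia.
    set (p := nth i V 0) in *. set (q := nth (S i) V 0) in *.
    set (n := dir ((p + q) / 2)). set (d := cos ((q - p) / 2)).
    assert (Hrange : forall k, (k < length V)%nat -> 1 <= nth k V 0 <= 4)
      by (intros; apply V_range, nth_In; assumption).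
    assert (Hstrict : forall k, (k < length V)%nat -> k <> i -> k <> S i ->
                      dot n (dir (nth k V 0)) < d).
    { intros k Hk Hki Hkj. unfold n, d. rewrite dot_dir_mid.
      pose proof (Hrange k Hk). pose proof (Hrange i ltac:(lia)).
      pose proof (Hrange (S i) ltac:(lia)).
      fold p in H0. fold q in H1.
      assert (0 < sin ((nth k V 0 - p) / 2) * sin ((nth k V 0 - q) / 2)); [|lra].
      assert (Hpq : p + w <= q) by (apply (StronglySorted_nth V V_sorted); lia).
      apply sin_half_prod_pos; [lra|lra|].
      destruct (Nat.lt_trichotomy k i) as [Hlt|[Heq|Hgt]]; [|lia|].
      - pose proof (StronglySorted_nth V V_sorted k i ltac:(lia)) as Hs. cbv beta in Hs.
        fold p in Hs. nra.
      - pose proof (StronglySorted_nth V V_sorted (S i) k ltac:(lia)) as Hs. cbv beta in Hs.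
        fold q in Hs. nra. }
    assert (Hp : dot n (dir p) = d).
    { unfold n, d. rewrite dot_dir_mid. rewrite Rminus_diag.
      replace (0 / 2) with 0 by field. rewrite sin_0; ring. }
    assert (Hq : dot n (dir q) = d).
    { unfold n, d. rewrite dot_dir_mid. rewrite (Rminus_diag q).
      replace (0 / 2) with 0 by field. rewrite sin_0; ring. }
    assert (Hx : dot n x = d).
    { rewrite Ex, dot_lerp, Hp, Hq; ring. }
    destruct (Nat.eq_dec j (S i)) as [->|Hj].
    + left; split; [reflexivity|].
      assert (Hs : dot n (dir (nth m V 0)) < d) by (apply Hstrict; lia).
      rewrite Ey, dot_lerp in Hx. fold q in Hx. rewrite Hq in Hx.
      assert (u = 0) as -> by nra.
      rewrite Ey. unfold lerp. rewrite vertex_map_dir by lia.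
      unfold dir; simpl; f_equal; ring.
    + assert (Hs : dot n (dir (nth j V 0)) < d) by (apply Hstrict; lia).
      assert (Hs' : dot n (dir (nth m V 0)) <= d).
      { destruct (Nat.eq_dec m i) as [->|]; [right; exact Hp|].
        destruct (Nat.eq_dec m (S i)) as [->|]; [right; exact Hq|].
        left; apply Hstrict; lia. }
      (* Edge [j] starts strictly inside and reaches the line only at its far end [m]. That end is
         then [i] or [S i], which is possible only for the closing edge with [m = i = 0]. *)
      rewrite Ey, dot_lerp in Hx.
      assert (u = 1) as -> by nra.
      assert (Em : dot n (dir (nth m V 0)) = d) by lra.
      assert (m = i \/ m = S i) as Hmi.
      { destruct (Nat.eq_dec m i) as [|Hn1]; [tauto|].
        destruct (Nat.eq_dec m (S i)) as [|Hn2]; [tauto|].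
        pose proof (Hstrict m Hm Hn1 Hn2). lra. }
      right. rewrite length_map. repeat split; [lia|lia|].
      replace 0%nat with m by lia. rewrite Ey. unfold lerp.
      rewrite vertex_map_dir by lia. unfold dir; simpl; f_equal; ring.
Qed.

(** No vertex lies strictly between the angles [p] and [q], so the line through [dir p] and [dir q]
    has the whole polygon on one side; [p] and [q] need not be vertices. The bounds on [p] and [q]
    keep all differences [v - p] and [v - q] within one turn. *)
Lemma outside_arc p q x :
  -2 < p -> q < 1 + 2 * PI -> (forall v, In v V -> v <= p \/ q <= v) -> p <= q ->
  cos ((q - p) / 2) < dot (dir ((p + q) / 2)) x -> ~ in_polygon (map dir V) x.
Proof.
  intros Hp Hq Hv Hpq Hx. pose proof pi_gt_3.
  apply (outside_half_plane _ (dir ((p + q) / 2))).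
  - rewrite dot_dir_self; lra.
  - intros y Hy. apply in_map_iff in Hy as (v & <- & Hin).
    rewrite dot_dir_mid. pose proof (V_range v Hin). specialize (Hv v Hin).
    assert (0 <= sin ((v - p) / 2) * sin ((v - q) / 2)); [|lra].
    apply sin_half_prod_nonneg; lra.
Qed.

(** The tangent at [dir a] separates: it is the case [p = q = a] of [dot_dir_mid], where the product
    is a square. *)
Lemma circle_outside a :
  0 <= a <= 2 * PI -> ~ In a V -> ~ in_polygon (map dir V) (dir a).
Proof.
  intros Ha Hn. pose proof pi_gt_3.
  apply (outside_half_plane _ (dir a)).
  - rewrite dot_dir_self; lra.
  - intros y Hy. apply in_map_iff in Hy as (v & <- & Hin).
    rewrite dot_dir_self. rewrite <- (dot_dir_self v).
    replace a with ((a + a) / 2) by field. rewrite dot_dir_mid.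
    replace ((a - a) / 2) with 0 by field. rewrite cos_0, dot_dir_self.
    pose proof (V_range v Hin).
    assert (v <> a) by congruence.
    assert (0 < sin ((v - a) / 2) * sin ((v - a) / 2)); [|lra].
    assert (v < a \/ a < v) by lra.
    apply sin_half_prod_pos; nra.
Qed.

(* If a vertex [v] lies under the arc of the chord, then the edge line through
   the endpoints of the arc of length [w] starting (or ending) at [v] cuts off
   the far end of the chord. *)
Lemma chord_outside_above theta v s :
  0 <= theta < 2 * PI -> w <= 1 / 10 ->
  In v V -> theta < v -> v <= theta + w / 2 -> 4 / 5 <= s <= 1 ->
  ~ in_polygon (map dir V) (lerp (dir theta) (dir (theta + w)) s).
Proof.
  intros Ht Hw Hv H1 H2 Hs. pose proof pi_gt_3. pose proof (V_range v Hv).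
  apply (outside_arc v (v + w)); try lra.
  - intros u Hu.
    destruct (StronglySorted_apart w V V_sorted u v Hu Hv); lra.
  - rewrite dot_lerp, !dot_dir_mid.
    replace ((theta - v) / 2) with (- ((v - theta) / 2)) by field.
    replace ((theta - (v + w)) / 2) with (- ((theta + w - v) / 2 + (v - theta))) by field.
    replace ((theta + w - (v + w)) / 2) with (- ((v - theta) / 2)) by field.
    rewrite !sin_neg.
    pose proof (sin_weighted_lt ((theta + w - v) / 2) (v - theta) (1 - s)
                  ltac:(lra) ltac:(lra) ltac:(lra) ltac:(lra) ltac:(lra)) as HS.
    assert (0 < sin ((v - theta) / 2)) by (apply sin_half_pos; pose proof pi_gt_3; lra).
    nra.
Qed.

Lemma chord_outside_below theta v s :
  0 <= theta < 2 * PI -> w <= 1 / 10 ->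
  In v V -> theta + w / 2 <= v -> v < theta + w -> 0 <= s <= 1 / 5 ->
  ~ in_polygon (map dir V) (lerp (dir theta) (dir (theta + w)) s).
Proof.
  intros Ht Hw Hv H1 H2 Hs. pose proof pi_gt_3. pose proof (V_range v Hv).
  apply (outside_arc (v - w) v); try lra.
  - intros u Hu.
    destruct (StronglySorted_apart w V V_sorted u v Hu Hv); lra.
  - rewrite dot_lerp, !dot_dir_mid.
    replace ((theta - (v - w)) / 2) with ((theta + w - v) / 2) by field.
    replace ((theta - v) / 2) with (- ((v - theta) / 2)) by field.
    replace ((theta + w - (v - w)) / 2) with ((v - theta) / 2 + (theta + w - v)) by field.
    rewrite !sin_neg.
    pose proof (sin_weighted_lt ((v - theta) / 2) (theta + w - v) s
                  ltac:(lra) ltac:(lra) ltac:(lra) ltac:(lra) ltac:(lra)) as HS.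
    assert (0 < sin ((theta + w - v) / 2)) by (apply sin_half_pos; pose proof pi_gt_3; lra).
    nra.
Qed.

(** The cap [eta <= w] serves the later extension of an arc by [eta], which must respect the bounds
    of [outside_arc]. *)
Lemma isolated_below (l : list R) a :
  exists eta, 0 < eta <= w /\ forall v, In v l -> v < a -> v <= a - eta.
Proof.
  induction l as [|x l (eta & He & IH)].
  - exists w; split; [lra|]. intros v [].
  - destruct (Rlt_dec x a) as [Hx|Hx].
    + exists (Rmin eta (a - x)). pose proof (Rmin_l eta (a - x)).
      pose proof (Rmin_r eta (a - x)). split.
      * split; [apply Rmin_glb_lt|]; lra.
      * intros v [<-|Hv] Hva; [lra|]. specialize (IH v Hv Hva). lra.
    + exists eta. split; [assumption|]. intros v [<-|Hv] Hva; [lra|auto].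
Qed.

Lemma isolated_above (l : list R) a :
  exists eta, 0 < eta <= w /\ forall v, In v l -> a < v -> a + eta <= v.
Proof.
  destruct (isolated_below (map Ropp l) (- a)) as (eta & He & H).
  exists eta; split; [assumption|]. intros v Hv Hav.
  specialize (H (- v) (in_map _ _ _ Hv)). lra.
Qed.

(** If a vertex lies strictly under the arc of the chord, it cuts off the end farther from it.
    Otherwise an endpoint of the arc is not a vertex, and the arc can be prolonged a little past it
    without meeting one; the chord of the longer arc then separates all points of the short chord
    except the endpoint in common. *)
Lemma chord_outside theta :
  0 <= theta < 2 * PI -> w <= 1 / 10 ->
  ~ (In theta V /\ In (theta + w) V) ->
  (forall s, 0 < s <= 1 / 5 ->
     ~ in_polygon (map dir V) (lerp (dir theta) (dir (theta + w)) s)) \/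
  (forall s, 4 / 5 <= s < 1 ->
     ~ in_polygon (map dir V) (lerp (dir theta) (dir (theta + w)) s)).
Proof.
  intros Ht Hw Hn. pose proof pi_gt_3.
  destruct (classic (exists v, In v V /\ theta < v < theta + w)) as [(v & Hv & Hvt)|Hnone].
  { destruct (Rle_dec v (theta + w / 2)).
    - right; intros s Hs. apply (chord_outside_above theta v); lra || assumption.
    - left; intros s Hs. apply (chord_outside_below theta v); lra || assumption. }
  assert (Hout : forall v, In v V -> v <= theta \/ theta + w <= v).
  { intros v Hv. destruct (Rle_dec v theta); [tauto|].
    destruct (Rle_dec (theta + w) v); [tauto|].
    exfalso; apply Hnone; exists v; split; [assumption|lra]. }
  destruct (in_dec Req_dec_T theta V) as [H1|H1];
    [destruct (in_dec Req_dec_T (theta + w) V) as [H2|H2]; [tauto|]|].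
  (* Only [theta] is a vertex, so the arc is prolonged beyond [theta + w]. The two chords share the
     endpoint at parameter 0. *)
  - destruct (isolated_above V (theta + w)) as (eta & He & Hiso).
    left; intros s Hs. apply (outside_arc theta (theta + w + eta)); try lra.
    + intros v Hv. destruct (Hout v Hv) as [|Hge]; [lra|right].
      apply Hiso; [assumption|]. destruct Hge as [|E]; [assumption|].
      subst v; tauto.
    + rewrite dot_lerp, !dot_dir_mid. rewrite Rminus_diag.
      replace (0 / 2) with 0 by field. rewrite sin_0.
      replace ((theta + w - (theta + w + eta)) / 2) with (- (eta / 2)) by field.
      replace ((theta + w - theta) / 2) with (w / 2) by field.
      rewrite sin_neg.
      assert (0 < sin (w / 2)) by (apply sin_half_pos; lra).
      assert (0 < sin (eta / 2)) by (apply sin_half_pos; lra).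
      assert (0 < s * (sin (w / 2) * sin (eta / 2)))
        by (repeat apply Rmult_lt_0_compat; lra).
      lra.
  - destruct (isolated_below V theta) as (eta & He & Hiso).
    right; intros s Hs. apply (outside_arc (theta - eta) (theta + w)); try lra.
    + intros v Hv. destruct (Hout v Hv) as [Hle|]; [left|lra].
      apply Hiso; [assumption|]. destruct Hle as [|E]; [assumption|].
      subst v; tauto.
    + rewrite dot_lerp, !dot_dir_mid. rewrite (Rminus_diag (theta + w)).
      replace (0 / 2) with 0 by field. rewrite sin_0.
      replace ((theta - (theta + w)) / 2) with (- (w / 2)) by field.
      replace ((theta - (theta - eta)) / 2) with (eta / 2) by field.
      rewrite sin_neg.
      assert (0 < sin (w / 2)) by (apply sin_half_pos; lra).
      assert (0 < sin (eta / 2)) by (apply sin_half_pos; lra).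
      assert (0 < (1 - s) * (sin (w / 2) * sin (eta / 2)))
        by (repeat apply Rmult_lt_0_compat; lra).
      lra.
Qed.

End Inscribed.

(** * The gadget *)

Definition holds (P : Prop) : bool :=
  if excluded_middle_informative P then true else false.

Lemma holds_true P : holds P = true <-> P.
Proof. unfold holds. destruct excluded_middle_informative; intuition discriminate. Qed.

Lemma filter_length_incl {A} (f : A -> bool) (l m : list A) :
  NoDup l -> (forall x, In x l -> f x = true -> In x m) ->
  (length (filter f l) <= length m)%nat.
Proof.
  intros Hl H. apply NoDup_incl_length; [apply NoDup_filter; assumption|].
  intros x Hx. apply filter_In in Hx as []; auto.
Qed.

Lemma filter_length_ge {A} (f : A -> bool) (l m : list A) :
  NoDup m -> (forall x, In x m -> In x l /\ f x = true) ->
  (length m <= length (filter f l))%nat.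
Proof.
  intros Hm H. apply NoDup_incl_length; [assumption|].
  intros x Hx. apply filter_In; auto.
Qed.

Lemma filter_none {A} (f : A -> bool) l :
  (forall x, In x l -> f x = false) -> filter f l = [].
Proof.
  intros H. rewrite (filter_ext_in f (fun _ => false)) by assumption.
  induction l; simpl; auto with datatypes.
Qed.

Lemma filter_map_length {A B} (f : B -> bool) (g : A -> B) l :
  length (filter f (map g l)) = length (filter (fun x => f (g x)) l).
Proof.
  induction l as [|a l IH]; simpl; [reflexivity|].
  destruct (f (g a)); simpl; congruence.
Qed.

(* The shifts by multiples of [1/60] make [shift2 a + shift2 b + shift1 c = 0]
   equivalent to [a + b + c = 0] together with the sign condition that [a] and
   [b] are both positive and [c] is not, or conversely. Two of the three
   numbers of such a triple can then coincide only if these are [a] and [b]. *)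
Definition shift1 (y : R) : R := if Rlt_dec 0 y then y else y - 1 / 30.

Definition shift2 (y : R) : R := if Rlt_dec 0 y then y + 1 / 60 else y.

(* [11 / 10] is the dummy position: it matches the first three point angles with
   the first three sum angles, and nothing else. Point and sum angles of the
   numbers come in two copies, which match only each other. *)
Definition positions (L : list R) : list R :=
  11 / 10 :: map (fun y => 3 / 2 + shift1 y) L.

(** The list is reversed because [3 - shift2 y] decreases in [y], and the vertices must be listed in
    increasing order of angle. *)
Definition sum_angles (L : list R) : list R :=
  [27 / 10; 28 / 10; 29 / 10] ++
  map (fun y => 3 - shift2 y) (rev L) ++ map (fun y => 61 / 20 - shift2 y) (rev L).

Definition vertex_angles (L : list R) (w : R) : list R :=
  flat_map (fun t => [t; t + w]) (positions L) ++ sum_angles L.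

(** Rotated by the position of [c], the first copy of [a] arrives at [3 + shift2 a + shift1 c],
    which is the first sum angle of [b] exactly when the shifted numbers add up to zero. The second
    copies are the first ones moved by [1 / 20] on both sides. *)
Definition point_angles (L : list R) : list R :=
  [16 / 10; 17 / 10; 18 / 10] ++
  flat_map (fun y => [3 / 2 + shift2 y; 31 / 20 + shift2 y]) L.

(** These are [n] distinct parameters in [(0, 1 / 5]], the range that [chord_outside] handles.
    Leaving out 0 keeps the chord points off the circle. *)
Definition low_params (n : nat) : list R :=
  map (fun j => INR (S j) / (5 * INR n)) (seq 0 n).

Definition high_params (n : nat) : list R :=
  map (fun j => 1 - INR (S j) / (5 * INR n)) (seq 0 n).

Definition chord_point (w s : R) : point := lerp (dir 0) (dir w) s.

Definition gadget_region (L : list R) (w : R) : polygon :=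
  map dir (vertex_angles L w).

Definition gadget_points (L : list R) (w : R) : list point :=
  map (chord_point w) (low_params (length (point_angles L))) ++
  map (chord_point w) (high_params (length (point_angles L))) ++
  map dir (point_angles L).

Lemma low_params_range n s : In s (low_params n) -> 0 < s <= 1 / 5.
Proof.
  intros H. apply in_map_iff in H as (j & <- & Hj). apply in_seq in Hj.
  assert (0 < INR n) by (apply lt_0_INR; lia).
  assert (0 < INR (S j) <= INR n) by (split; [apply lt_0_INR|apply le_INR]; lia).
  split.
  - apply Rdiv_lt_0_compat; lra.
  - apply (Rmult_le_reg_r (5 * INR n)); [lra|]. field_simplify; lra.
Qed.

Lemma high_params_low n s : In s (high_params n) -> In (1 - s) (low_params n).
Proof.
  intros H. apply in_map_iff in H as (j & <- & Hj).
  apply in_map_iff. exists j. split; [ring|assumption].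
Qed.

Lemma low_params_NoDup n : NoDup (low_params n).
Proof.
  apply NoDup_map_NoDup_ForallPairs; [|apply seq_NoDup].
  intros i j Hi Hj E. apply in_seq in Hi, Hj.
  assert (0 < INR n) by (apply lt_0_INR; lia).
  apply Rdiv_eq_reg_r in E; [|lra]. apply INR_eq in E. lia.
Qed.

Lemma high_params_NoDup n : NoDup (high_params n).
Proof.
  unfold high_params. rewrite <- (map_map (fun j => INR (S j) / (5 * INR n)) (fun s => 1 - s)).
  apply NoDup_map_NoDup_ForallPairs; [|apply low_params_NoDup].
  intros x y _ _ E. lra.
Qed.

Lemma flat_map_pair_length {A B} (f g : A -> B) l :
  length (flat_map (fun x => [f x; g x]) l) = (length l + length l)%nat.
Proof. induction l; simpl; lia. Qed.

Lemma low_params_length n : length (low_params n) = n.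
Proof. unfold low_params. rewrite length_map, length_seq; reflexivity. Qed.

Lemma high_params_length n : length (high_params n) = n.
Proof. unfold high_params. rewrite length_map, length_seq; reflexivity. Qed.

Lemma point_angles_length L : length (point_angles L) = (length L + length L + 3)%nat.
Proof.
  unfold point_angles. rewrite length_app, flat_map_pair_length. simpl. lia.
Qed.

Lemma gadget_points_length L w : length (gadget_points L w) =
  (length (point_angles L) + length (point_angles L) + length (point_angles L))%nat.
Proof.
  unfold gadget_points. rewrite !length_app, !length_map, low_params_length, high_params_length.
  lia.
Qed.

Lemma gadget_region_length L w :
  length (gadget_region L w) = (length L + length L + (length L + length L) + 5)%nat.
Proof.
  unfold gadget_region, vertex_angles, sum_angles, positions.
  rewrite length_map, !length_app, !length_map, length_rev, flat_map_pair_length.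
  simpl. rewrite length_map. lia.
Qed.

Section Gadget.

Variables (L : list R) (w : R).
Hypothesis w_range : 0 < w <= 1 / 480.
(** A gap of [3 * w] still leaves [2 * w] once each position [t] is followed by the vertex [t + w],
    so no two positions create an unintended pair at distance [w]. *)
Hypothesis L_sorted : StronglySorted (fun u v => u + 3 * w <= v) L.
Hypothesis L_range : forall y, In y L -> - (1 / 240) <= y <= 1 / 240.

Lemma positions_sorted : StronglySorted (fun u v => u + 3 * w <= v) (positions L).
Proof.
  unfold positions. constructor.
  - clear L_range. induction L_sorted as [|a l Hs IH Hf]; simpl; constructor; [auto|].
    rewrite Forall_forall in *. intros x Hx. apply in_map_iff in Hx as (y & <- & Hy).
    specialize (Hf y Hy). unfold shift1. repeat destruct Rlt_dec; lra.
  - apply Forall_forall. intros x Hx. apply in_map_iff in Hx as (y & <- & Hy).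
    specialize (L_range y Hy). unfold shift1. repeat destruct Rlt_dec; lra.
Qed.

Lemma map_rev_sorted (f : R -> R) l g :
  (forall x y, x + g <= y -> f y + g <= f x) ->
  StronglySorted (fun u v => u + g <= v) l ->
  StronglySorted (fun u v => u + g <= v) (map f (rev l)).
Proof.
  intros Hf. induction 1 as [|a l Hs IH Ha]; simpl; [constructor|].
  rewrite map_app. apply StronglySorted_app; [assumption|repeat constructor|].
  simpl. intros x y Hx [<-|[]]. apply in_map_iff in Hx as (z & <- & Hz).
  apply in_rev in Hz. rewrite Forall_forall in Ha. auto.
Qed.

Lemma sum_angles_cases u : In u (sum_angles L) ->
  u = 27 / 10 \/ u = 28 / 10 \/ u = 29 / 10 \/
  (exists y, In y L /\ u = 3 - shift2 y) \/ (exists y, In y L /\ u = 61 / 20 - shift2 y).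
Proof.
  unfold sum_angles. rewrite !in_app_iff, !in_map_iff. simpl.
  intros [H|[(y & <- & Hy)|(y & <- & Hy)]]; [intuition| |];
    apply in_rev in Hy; eauto 10.
Qed.

Lemma sum_angles_range u : In u (sum_angles L) -> 27 / 10 <= u <= 31 / 10.
Proof.
  intros H. apply sum_angles_cases in H.
  destruct H as [->|[->|[->|[(y & Hy & ->)|(y & Hy & ->)]]]]; try lra;
    specialize (L_range y Hy); unfold shift2; destruct Rlt_dec; lra.
Qed.

Lemma sum_angles_sorted : StronglySorted (fun u v => u + 3 * w <= v) (sum_angles L).
Proof.
  unfold sum_angles. apply StronglySorted_app; [|apply StronglySorted_app|].
  - repeat constructor; lra.
  - apply map_rev_sorted; [|assumption].
    intros x y Hxy. unfold shift2. repeat destruct Rlt_dec; lra.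
  - apply map_rev_sorted; [|assumption].
    intros x y Hxy. unfold shift2. repeat destruct Rlt_dec; lra.
  - intros x y Hx Hy. apply in_map_iff in Hx as (a & <- & Ha), Hy as (b & <- & Hb).
    apply in_rev in Ha, Hb. apply L_range in Ha, Hb.
    unfold shift2. repeat destruct Rlt_dec; lra.
  - intros x y Hx Hy.
    assert (x <= 29 / 10) by (simpl in Hx; intuition lra).
    assert (29 / 10 + 3 * w <= y); [|lra].
    apply in_app_iff in Hy as [Hy|Hy]; apply in_map_iff in Hy as (a & <- & Ha);
      apply in_rev in Ha; apply L_range in Ha; unfold shift2; destruct Rlt_dec; lra.
Qed.

Lemma positions_range t : In t (positions L) -> 11 / 10 <= t <= 16 / 10.
Proof.
  intros [<-|H]; [lra|]. apply in_map_iff in H as (y & <- & Hy).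
  specialize (L_range y Hy). unfold shift1. destruct Rlt_dec; lra.
Qed.

Lemma doubled_sorted T : StronglySorted (fun u v => u + 3 * w <= v) T ->
  StronglySorted (fun u v => u + w <= v) (flat_map (fun t => [t; t + w]) T).
Proof.
  induction 1 as [|a l Hs IH Hf]; simpl; [constructor|].
  rewrite Forall_forall in Hf.
  assert (Hl : forall x, In x (flat_map (fun t => [t; t + w]) l) -> a + 2 * w <= x).
  { intros x Hx. apply in_flat_map in Hx as (t & Ht & Hx). specialize (Hf t Ht).
    simpl in Hx. intuition lra. }
  constructor; [constructor; [assumption|]|]; apply Forall_forall.
  - intros x Hx. specialize (Hl x Hx). lra.
  - intros x [<-|Hx]; [lra|]. specialize (Hl x Hx). lra.
Qed.

Lemma vertex_angles_cases v : In v (vertex_angles L w) ->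
  In v (positions L) \/ (exists t, In t (positions L) /\ v = t + w) \/ In v (sum_angles L).
Proof.
  unfold vertex_angles. rewrite in_app_iff, in_flat_map.
  intros [(t & Ht & [<-|[<-|[]]])|H]; eauto.
Qed.

Lemma vertex_angles_range v : In v (vertex_angles L w) -> 1 <= v <= 4.
Proof.
  intros H. apply vertex_angles_cases in H as [H|[(t & H & ->)|H]].
  - apply positions_range in H; lra.
  - apply positions_range in H; lra.
  - apply sum_angles_range in H; lra.
Qed.

Lemma vertex_angles_sorted :
  StronglySorted (fun u v => u + w <= v) (vertex_angles L w).
Proof.
  unfold vertex_angles. apply StronglySorted_app.
  - apply doubled_sorted, positions_sorted.
  - pose proof sum_angles_sorted as H. induction H as [|a l Hs IH Hf]; constructor; [auto|].
    rewrite Forall_forall in *. intros x Hx. specialize (Hf x Hx). lra.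
  - intros x y Hx Hy. apply in_flat_map in Hx as (t & Ht & Hx).
    apply positions_range in Ht. apply sum_angles_range in Hy.
    simpl in Hx. intuition lra.
Qed.

(** Positions are at least [3 * w] apart, and so are sum angles; the two groups are far from each
    other. Hence the distance [w] occurs only inside the pair belonging to one position. *)
Lemma position_iff theta :
  In theta (vertex_angles L w) -> In (theta + w) (vertex_angles L w) ->
  In theta (positions L).
Proof.
  intros H1 H2. apply vertex_angles_cases in H1, H2.
  pose proof (StronglySorted_apart _ _ positions_sorted) as HP.
  pose proof (StronglySorted_apart _ _ sum_angles_sorted) as HS.
  destruct H1 as [H1|[(t & H1 & ->)|H1]]; [assumption|exfalso|exfalso].
  - destruct H2 as [H2|[(t' & H2 & E)|H2]].
    + destruct (HP _ _ H1 H2) as [|[|]]; lra.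
    + destruct (HP _ _ H1 H2) as [|[|]]; lra.
    + apply positions_range in H1. apply sum_angles_range in H2. lra.
  - destruct H2 as [H2|[(t' & H2 & E)|H2]].
    + apply sum_angles_range in H1. apply positions_range in H2. lra.
    + apply sum_angles_range in H1. apply positions_range in H2. lra.
    + destruct (HS _ _ H1 H2) as [|[|]]; lra.
Qed.

Lemma gadget_simple : simple_polygon (gadget_region L w).
Proof.
  apply (inscribed_simple _ w); [lra|apply vertex_angles_sorted|apply vertex_angles_range|].
  unfold vertex_angles, sum_angles. rewrite !length_app. simpl. lia.
Qed.

Lemma point_angles_cases p : In p (point_angles L) ->
  p = 16 / 10 \/ p = 17 / 10 \/ p = 18 / 10 \/
  (exists y, In y L /\ (p = 3 / 2 + shift2 y \/ p = 31 / 20 + shift2 y)).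
Proof.
  unfold point_angles. rewrite in_app_iff, in_flat_map.
  intros [H|(y & Hy & Hp)].
  - simpl in H. intuition.
  - right; right; right. exists y. simpl in Hp. intuition.
Qed.

Lemma point_angles_range p : In p (point_angles L) -> 1 <= p <= 2.
Proof.
  intros H. apply point_angles_cases in H.
  destruct H as [->|[->|[->|(y & Hy & H)]]]; try lra.
  specialize (L_range y Hy). unfold shift2 in H. destruct Rlt_dec; lra.
Qed.

Lemma L_NoDup : NoDup L.
Proof. apply (StronglySorted_NoDup (3 * w)); [lra|assumption]. Qed.

Lemma shift2_inj x y : In x L -> In y L -> shift2 x = shift2 y -> x = y.
Proof.
  intros Hx Hy. apply L_range in Hx, Hy. unfold shift2. repeat destruct Rlt_dec; lra.
Qed.

Lemma point_angles_NoDup : NoDup (point_angles L).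
Proof.
  unfold point_angles. apply NoDup_app.
  - repeat constructor; simpl; lra.
  - assert (H : forall l, incl l L -> NoDup l ->
      NoDup (flat_map (fun y => [3 / 2 + shift2 y; 31 / 20 + shift2 y]) l)).
    2: { apply H; [apply incl_refl|apply L_NoDup]. }
    intros l Hincl Hnd. induction Hnd as [|a l Ha Hl IH]; simpl; [constructor|].
    assert (Hrest : forall x, In x (flat_map (fun y => [3 / 2 + shift2 y; 31 / 20 + shift2 y]) l) ->
       x <> 3 / 2 + shift2 a /\ x <> 31 / 20 + shift2 a).
    { intros x Hx. apply in_flat_map in Hx as (y & Hy & Hx).
      assert (y <> a) by congruence.
      assert (HaL : In a L) by (apply Hincl; left; reflexivity).
      assert (HyL : In y L) by (apply Hincl; right; assumption).
      pose proof (shift2_inj y a HyL HaL). apply L_range in HaL, HyL.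
      simpl in Hx. split; intros E; subst x; destruct Hx as [E|[E|[]]];
        try (apply H, H0; lra);
        unfold shift2 in E; repeat destruct Rlt_dec; lra. }
    constructor; [|constructor].
    + intros [E|Hin]; [lra|]. apply Hrest in Hin. tauto.
    + intros Hin. apply Hrest in Hin. tauto.
    + apply IH. intros x Hx; apply Hincl; right; assumption.
  - intros x Hx Hin. apply in_flat_map in Hin as (y & Hy & Hin).
    apply L_range in Hy. simpl in Hx, Hin. unfold shift2 in Hin.
    destruct Rlt_dec; lra.
Qed.

Lemma chord_point_inj s t : chord_point w s = chord_point w t -> s = t.
Proof.
  unfold chord_point, lerp, dir; simpl. intros E. injection E as _ E.
  rewrite sin_0 in E. pose proof pi_gt_3.
  assert (0 < sin w) by (apply sin_gt_0; lra). nra.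
Qed.

(** The squared norm of the chord point is [1 - 2 * s * (1 - s) * (1 - cos w)], which is below 1. *)
Lemma chord_point_not_dir s a : 0 < s < 1 -> chord_point w s <> dir a.
Proof.
  intros Hs E. pose proof pi_gt_3.
  assert (H1 : dot (dir (w / 2)) (chord_point w s) = cos (w / 2)).
  { unfold chord_point. rewrite dot_lerp, !dot_dir.
    replace (0 - w / 2) with (- (w / 2)) by field. rewrite cos_neg.
    replace (w - w / 2) with (w / 2) by field. ring. }
  assert (H2 : dot (chord_point w s) (chord_point w s) = 1 - 2 * s * (1 - s) * (1 - cos w)).
  { unfold chord_point at 2. rewrite dot_lerp. unfold chord_point, dot, lerp, dir; simpl.
    rewrite cos_0, sin_0. pose proof (sin2_cos2 w) as Q; unfold Rsqr in Q.
    transitivity (1 - 2 * s + s * s + 2 * s * (1 - s) * cos w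
                  + s * s * (sin w * sin w + cos w * cos w)); [ring|].
    rewrite Q; ring. }
  rewrite E, dot_dir_self in H2.
  assert (cos w < 1).
  { rewrite <- cos_0. apply cos_decreasing_1; lra. }
  assert (0 < s * (1 - s) * (1 - cos w)) by (repeat apply Rmult_lt_0_compat; lra).
  lra.
Qed.

Lemma high_params_range n s : In s (high_params n) -> 4 / 5 <= s < 1.
Proof. intros H. apply high_params_low, low_params_range in H. lra. Qed.

Lemma gadget_points_NoDup : NoDup (gadget_points L w).
Proof.
  unfold gadget_points. set (n := length (point_angles L)).
  apply NoDup_app; [|apply NoDup_app|].
  - apply NoDup_map_NoDup_ForallPairs; [|apply low_params_NoDup].
    intros x y _ _; apply chord_point_inj.
  - apply NoDup_map_NoDup_ForallPairs; [|apply high_params_NoDup].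
    intros x y _ _; apply chord_point_inj.
  - apply NoDup_map_NoDup_ForallPairs; [|apply point_angles_NoDup].
    intros x y Hx Hy. apply point_angles_range in Hx, Hy.
    pose proof pi_gt_3. apply dir_inj; lra.
  - intros x Hx Hy. apply in_map_iff in Hx as (s & <- & Hs), Hy as (p & E & Hp).
    apply high_params_range in Hs. symmetry in E. revert E.
    apply chord_point_not_dir; lra.
  - intros x Hx Hy. apply in_map_iff in Hx as (s & <- & Hs).
    apply low_params_range in Hs. apply in_app_iff in Hy as [Hy|Hy].
    + apply in_map_iff in Hy as (t & E & Ht). apply high_params_range in Ht.
      apply chord_point_inj in E. lra.
    + apply in_map_iff in Hy as (p & E & Hp). symmetry in E. revert E.
      apply chord_point_not_dir; lra.
Qed.

Definition gadget : mcr_instance :=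
  MCRInstance (0, 0) (gadget_region L w) (gadget_points L w)
    gadget_simple gadget_points_NoDup.

(** * Counting the covered points *)

Definition covered (theta : R) (s : point) : bool :=
  holds (in_rotated (0, 0) (gadget_region L w) theta s).

Definition matches (t : R) : list R :=
  filter (fun p => holds (In (p + t) (sum_angles L))) (point_angles L).

Let count := cover (0, 0) (gadget_region L w) (gadget_points L w).

Lemma covered_chord theta s : covered theta (chord_point w s) = true <->
  in_polygon (gadget_region L w) (lerp (dir theta) (dir (theta + w)) s).
Proof.
  unfold covered. rewrite holds_true, in_rotated_origin.
  unfold chord_point. rewrite rotate_ccw_lerp, !rotate_ccw_dir.
  rewrite Rplus_0_l, (Rplus_comm w). reflexivity.
Qed.

Lemma covered_dir theta p : covered theta (dir p) = true <->
  in_polygon (gadget_region L w) (dir (p + theta)).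
Proof.
  unfold covered. rewrite holds_true, in_rotated_origin, rotate_ccw_dir. reflexivity.
Qed.

Lemma count_split theta :
  count theta =
  (length (filter (fun s => covered theta (chord_point w s)) (low_params (length (point_angles L)))) +
   length (filter (fun s => covered theta (chord_point w s)) (high_params (length (point_angles L)))) +
   length (filter (fun p => covered theta (dir p)) (point_angles L)))%nat.
Proof.
  unfold count, cover. change (fun s => if excluded_middle_informative _ then true else false)
    with (covered theta).
  unfold gadget_points. rewrite !filter_app, !length_app, !filter_map_length. lia.
Qed.

(** One of the two groups of chord points is lost completely, and each of the three groups of points
    has the size of [point_angles L]. *)
Lemma count_elsewhere theta :
  0 <= theta < 2 * PI -> ~ In theta (positions L) ->
  (count theta <= 2 * length (point_angles L))%nat.
Proof.
  intros Ht Hn. rewrite count_split.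
  pose proof (filter_length_le (fun s => covered theta (chord_point w s)) (low_params (length (point_angles L)))) as H1.
  pose proof (filter_length_le (fun s => covered theta (chord_point w s)) (high_params (length (point_angles L)))) as H2.
  pose proof (filter_length_le (fun p => covered theta (dir p)) (point_angles L)) as H3.
  rewrite low_params_length in H1. rewrite high_params_length in H2.
  destruct (chord_outside (vertex_angles L w) w ltac:(lra) vertex_angles_sorted
              vertex_angles_range theta Ht ltac:(lra)) as [H|H].
  - intros [Ha Hb]. apply Hn, position_iff; assumption.
  - rewrite (filter_none _ (low_params _)); [cbn [length]; lia|].
    intros s Hs. apply Bool.not_true_is_false. rewrite covered_chord.
    apply H, (low_params_range _ _ Hs).
  - rewrite (filter_none _ (high_params _)); [cbn [length]; lia|].
    intros s Hs. apply Bool.not_true_is_false. rewrite covered_chord.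
    apply H, (high_params_range _ _ Hs).
Qed.

Lemma nth_flat_map_doubled T t : In t T ->
  exists i, (S i < length (flat_map (fun t => [t; (t + w)%R]) T))%nat /\
    nth i (flat_map (fun t => [t; t + w]) T) 0 = t /\
    nth (S i) (flat_map (fun t => [t; t + w]) T) 0 = t + w.
Proof.
  induction T as [|a T IH]; simpl; [tauto|]. intros [<-|H].
  - exists 0%nat. simpl. repeat split; lia.
  - destruct (IH H) as (i & Hi & E1 & E2). exists (S (S i)). simpl.
    repeat split; [lia|assumption|assumption].
Qed.

Lemma position_edge t s : In t (positions L) -> 0 <= s <= 1 ->
  in_polygon (gadget_region L w) (lerp (dir t) (dir (t + w)) s).
Proof.
  intros Ht Hs. destruct (nth_flat_map_doubled _ _ Ht) as (i & Hi & E1 & E2).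
  assert (Hlen : (S i < length (vertex_angles L w))%nat)
    by (unfold vertex_angles; rewrite length_app; lia).
  left. exists i. unfold gadget_region. rewrite length_map. split; [lia|].
  exists s; split; [assumption|]. rewrite length_map.
  rewrite Nat.mod_small by assumption. rewrite !vertex_map_dir by lia.
  unfold vertex_angles. rewrite !app_nth1 by lia. rewrite E1, E2. reflexivity.
Qed.

Lemma filter_all {A} (f : A -> bool) l :
  (forall x, In x l -> f x = true) -> filter f l = l.
Proof. intros H. apply forallb_filter_id, forallb_forall, H. Qed.

(** The chord lies on an edge, so all its points are covered. A point of the circle is covered only
    at a vertex; its angle [p + t] is at least [21 / 10], beyond the position pairs, so that vertex
    is a sum angle. *)
Lemma count_position t : In t (positions L) ->
  count t = (2 * length (point_angles L) + length (matches t))%nat.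
Proof.
  intros Ht. rewrite count_split. pose proof (positions_range t Ht) as Hr.
  rewrite (filter_all _ (low_params _)), (filter_all _ (high_params _)).
  - rewrite low_params_length, high_params_length.
    unfold matches. rewrite (filter_ext_in (fun p => covered t (dir p))
      (fun p => holds (In (p + t) (sum_angles L)))); [lia|].
    intros p Hp. pose proof (point_angles_range p Hp). pose proof pi_gt_3.
    apply Bool.eq_iff_eq_true. rewrite covered_dir, holds_true. split.
    + intros H1. destruct (classic (In (p + t) (vertex_angles L w))) as [H2|H2].
      * apply vertex_angles_cases in H2 as [H2|[(u & H2 & E)|H2]]; [| |assumption];
          apply positions_range in H2; lra.
      * exfalso. revert H1. apply circle_outside; [apply vertex_angles_range|lra|assumption].
    + intros H1. apply in_polygon_vertex, in_map. unfold vertex_angles.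
      apply in_app_iff. tauto.
  - intros s Hs. apply covered_chord, position_edge; [assumption|].
    apply high_params_range in Hs; lra.
  - intros s Hs. apply covered_chord, position_edge; [assumption|].
    apply low_params_range in Hs; lra.
Qed.

Lemma matches_default : length (matches (11 / 10)) = 3%nat.
Proof.
  apply Nat.le_antisymm.
  - apply (filter_length_incl _ _ [16 / 10; 17 / 10; 18 / 10]); [apply point_angles_NoDup|].
    intros p Hp Hm. rewrite holds_true in Hm.
    apply point_angles_cases in Hp.
    destruct Hp as [->|[->|[->|(y & Hy & H)]]]; simpl; try tauto.
    (* The points encoding numbers reach at most [11 / 10 + 31 / 20 + 1 / 48], which is below the
       least sum angle [27 / 10]. *)
    exfalso. apply sum_angles_range in Hm.
    apply L_range in Hy. unfold shift2 in H. destruct Rlt_dec; lra.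
  - apply (filter_length_ge _ _ [16 / 10; 17 / 10; 18 / 10]).
    + repeat constructor; simpl; lra.
    + intros x Hx. split; [apply in_app_iff; left; assumption|].
      rewrite holds_true. apply in_app_iff. left. simpl in *.
      destruct Hx as [<-|[<-|[<-|[]]]]; [left|right;left|right;right;left]; lra.
Qed.

(** The total [shift2 a + shift2 b + shift1 c] is less than [1 / 20] in absolute value, so different
    copies never match. Within a copy it must vanish; since [a + b + c] is at most [1 / 80] in
    absolute value and the shifts add up to a multiple of [1 / 60], both vanish. The shifts cancel
    only if [c] is on the other side of the sign condition from [a] and [b]. *)
Lemma match_cases c p : In c L -> In p (point_angles L) ->
  In (p + (3 / 2 + shift1 c)) (sum_angles L) ->
  exists a b, In a L /\ In b L /\ a + b + c = 0 /\ a <> c /\ b <> c /\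
    (p = 3 / 2 + shift2 a \/ p = 31 / 20 + shift2 a).
Proof.
  intros Hc Hp Hm. pose proof (L_range c Hc).
  apply point_angles_cases in Hp.
  (* The lower bound exceeds [29 / 10], which excludes the three dummy sum angles. *)
  assert (Hlow : p + (3 / 2 + shift1 c) <= 3 + 1 / 10 /\ 3 - 1 / 15 <= p + (3/2 + shift1 c)).
  { apply sum_angles_range in Hm as ?.
    split; [lra|].
    destruct Hp as [->|[->|[->|(y & Hy & Hp)]]];
      [unfold shift1; destruct Rlt_dec; lra .. |].
    apply L_range in Hy. unfold shift1. unfold shift2 in Hp. repeat destruct Rlt_dec; lra. }
  apply sum_angles_cases in Hm.
  destruct Hm as [E|[E|[E|Hb]]]; [lra|lra|lra|].
  destruct Hp as [->|[->|[->|(a & Ha & Hp)]]].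
  (* A dummy point lands at [31 / 10 - 1 / 26] or higher, whereas the sum angles of numbers end at
     [61 / 20 + 1 / 240]. *)
  1-3: destruct Hb as [(b & Hb & E)|(b & Hb & E)]; apply L_range in Hb;
    unfold shift1, shift2 in E; repeat destruct Rlt_dec; lra.
  exists a. pose proof (L_range a Ha) as Hra.
  destruct Hb as [(b & Hb & E)|(b & Hb & E)]; pose proof (L_range b Hb) as Hrb;
    exists b; (split; [exact Ha|]); (split; [exact Hb|]);
    cut (a + b + c = 0 /\ a <> c /\ b <> c); [tauto| |tauto|];
    unfold shift1, shift2 in *; repeat destruct Rlt_dec; destruct Hp as [Hp|Hp];
    try lra; repeat split; try lra; intros ->; lra.
Qed.

(** By [match_cases] both [a] and [b] differ from [c], so without a zero triple they coincide. Then
    [a = - c / 2], and only its two copies can match. *)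
Lemma matches_no_triple c : In c L -> ~ has_zero_triple L ->
  (length (matches (3 / 2 + shift1 c)) <= 2)%nat.
Proof.
  intros Hc Hn.
  apply (filter_length_incl _ _ [3 / 2 + shift2 (- c / 2); 31 / 20 + shift2 (- c / 2)]);
    [apply point_angles_NoDup|].
  intros p Hp Hm. rewrite holds_true in Hm.
  destruct (match_cases c p Hc Hp Hm) as (a & b & Ha & Hb & E & Hac & Hbc & Hpa).
  destruct (Req_dec a b) as [<-|Hab].
  - replace (- c / 2) with a by lra. simpl. intuition.
  - exfalso. apply Hn. exists a, b, c. tauto.
Qed.

(** The roles of [a] and [b] can be exchanged, and each match occurs in two copies; this gives
    four. *)
Lemma matches_pair a b c : In a L -> In b L -> In c L -> a <> b -> a + b + c = 0 ->
  (0 < a /\ 0 < b /\ c <= 0 \/ a <= 0 /\ b <= 0 /\ 0 < c) ->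
  (4 <= length (matches (3 / 2 + shift1 c)))%nat.
Proof.
  intros Ha Hb Hc Hab E Hsign.
  pose proof (L_range a Ha). pose proof (L_range b Hb).
  apply (filter_length_ge _ _
    [3 / 2 + shift2 a; 31 / 20 + shift2 a; 3 / 2 + shift2 b; 31 / 20 + shift2 b]).
  - unfold shift2. repeat constructor; simpl; repeat destruct Rlt_dec; lra.
  - assert (Hpts : forall x, In x L -> In (3 / 2 + shift2 x) (point_angles L) /\
                                  In (31 / 20 + shift2 x) (point_angles L)).
    { intros x Hx. unfold point_angles. rewrite !in_app_iff, !in_flat_map.
      split; right; exists x; simpl; tauto. }
    assert (Hsum : forall x, In x L -> In (3 - shift2 x) (sum_angles L) /\
                                  In (61 / 20 - shift2 x) (sum_angles L)).
    { intros x Hx. apply in_rev in Hx. unfold sum_angles. rewrite !in_app_iff.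
      split; right; [left|right]; apply in_map_iff; exists x; tauto. }
    assert (Es : shift2 a + shift2 b + shift1 c = 0)
      by (unfold shift1, shift2; repeat destruct Rlt_dec; lra).
    intros x Hx. rewrite holds_true.
    destruct Hx as [<-|[<-|[<-|[<-|[]]]]]; (split; [apply Hpts; assumption|]).
    + replace (3 / 2 + shift2 a + (3 / 2 + shift1 c)) with (3 - shift2 b) by lra.
      apply Hsum; assumption.
    + replace (31 / 20 + shift2 a + (3 / 2 + shift1 c)) with (61 / 20 - shift2 b) by lra.
      apply Hsum; assumption.
    + replace (3 / 2 + shift2 b + (3 / 2 + shift1 c)) with (3 - shift2 a) by lra.
      apply Hsum; assumption.
    + replace (31 / 20 + shift2 b + (3 / 2 + shift1 c)) with (61 / 20 - shift2 a) by lra.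
      apply Hsum; assumption.
Qed.

Lemma matches_triple : has_zero_triple L ->
  exists c, In c L /\ (4 <= length (matches (3 / 2 + shift1 c)))%nat.
Proof.
  intros (a & b & c & Ha & Hb & Hc & Hab & Hac & Hbc & E).
  assert (H : (0 < a /\ 0 < b /\ c <= 0 \/ a <= 0 /\ b <= 0 /\ 0 < c) \/
              (0 < a /\ 0 < c /\ b <= 0 \/ a <= 0 /\ c <= 0 /\ 0 < b) \/
              (0 < b /\ 0 < c /\ a <= 0 \/ b <= 0 /\ c <= 0 /\ 0 < a)).
  (* Three distinct numbers with sum zero are neither all positive nor all nonpositive, so exactly
     one of them is alone on its side; that one selects the position. *)
  { destruct (Rlt_dec 0 a), (Rlt_dec 0 b), (Rlt_dec 0 c); lra. }
  destruct H as [H|[H|H]].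
  - exists c; split; [assumption|]. apply (matches_pair a b); assumption || lra.
  - exists b; split; [assumption|]. apply (matches_pair a c); assumption || lra.
  - exists a; split; [assumption|]. apply (matches_pair b c); assumption || lra.
Qed.

(** The dummy position gains 3 over every rotation that is not a position, so the optimum is a
    position. It loses to a position with 4 matches and beats all those with at most 2. The
    threshold [5 / 4] separates [11 / 10] from the positions of numbers, which are close to
    [3 / 2]. *)
Lemma gadget_answer theta : 0 <= theta < 2 * PI ->
  (forall phi, 0 <= phi < 2 * PI -> (count phi <= count theta)%nat) ->
  (has_zero_triple L <-> 5 / 4 <= theta).
Proof.
  intros Ht Hmax. pose proof pi_gt_3.
  assert (Hd : In (11 / 10) (positions L)) by (left; reflexivity).
  assert (Hc : forall c, In c L -> In (3 / 2 + shift1 c) (positions L))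
    by (intros c Hc; right; apply in_map_iff; exists c; tauto).
  pose proof (Hmax (11 / 10) ltac:(lra)) as H1.
  rewrite (count_position _ Hd), matches_default in H1.
  assert (Hpos : In theta (positions L)).
  { destruct (classic (In theta (positions L))) as [|Hn]; [assumption|].
    pose proof (count_elsewhere theta Ht Hn). lia. }
  rewrite (count_position _ Hpos) in H1, Hmax.
  split.
  - intros Htr. destruct (matches_triple Htr) as (c & Hcl & Hm).
    pose proof (positions_range _ (Hc c Hcl)).
    specialize (Hmax (3 / 2 + shift1 c) ltac:(lra)).
    rewrite (count_position _ (Hc c Hcl)) in Hmax.
    destruct Hpos as [<-|Hpos]; [rewrite matches_default in Hmax; lia|].
    apply in_map_iff in Hpos as (y & <- & Hy). apply L_range in Hy.
    unfold shift1. destruct Rlt_dec; lra.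
  - intros Hge. destruct (classic (has_zero_triple L)) as [|Hn]; [assumption|exfalso].
    destruct Hpos as [<-|Hpos]; [lra|].
    apply in_map_iff in Hpos as (y & <- & Hy).
    pose proof (matches_no_triple y Hy Hn). lia.
Qed.

End Gadget.

(** * Total correctness of programs with a time bound *)

Definition runs (O : list R -> list R) (c : cmd) (s : state) (n : nat)
    (Q : state -> Prop) : Prop :=
  exists s' t, exec O c s s' t [] /\ (t <= n)%nat /\ Q s'.

(** This covers straight-line code and conditionals; loops go through [runs_while] and an invariant,
    and the single oracle call is treated in the final proof. *)
Fixpoint wp (c : cmd) (Q : state -> Prop) (s : state) : Prop :=
  match c with
  | c_skip => Q s
  | c_iset x e => Q (set_ireg s x (ieval s e))
  | c_rset x e => exists v, reval s e = Some v /\ Q (set_rreg s x v)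
  | c_iput a e f => Q (set_iarr s a (ieval s e) (ieval s f))
  | c_rput a e f => exists v, reval s f = Some v /\ Q (set_rarr s a (ieval s e) v)
  | c_seq c d => wp c (wp d Q) s
  | c_if b c d => exists u, beval s b = Some u /\ if u then wp c Q s else wp d Q s
  | c_while _ _ | c_call _ _ => False
  end.

(** Charging a conditional for both branches keeps the bound free of maxima. *)
Fixpoint time_bound (c : cmd) : nat :=
  match c with
  | c_skip => 1
  | c_iset _ e => 1 + icost e
  | c_rset _ e => 1 + rcost e
  | c_iput _ e f => 1 + icost e + icost f
  | c_rput _ e f => 1 + icost e + rcost f
  | c_seq c d => time_bound c + time_bound d
  | c_if b c d => 1 + bcost b + (time_bound c + time_bound d)
  | c_while _ _ | c_call _ _ => 0
  end.

Lemma runs_wp O c Q s : wp c Q s -> runs O c s (time_bound c) Q.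
Proof.
  revert Q s. induction c; intros Q s H; simpl in H; try contradiction.
  - exists s, 1%nat. repeat split; [constructor|auto|assumption].
  - eexists _, _. repeat split; [constructor|apply le_n|assumption].
  - destruct H as (z & E & H). eexists _, _.
    repeat split; [constructor; eassumption|apply le_n|assumption].
  - eexists _, _. repeat split; [constructor|apply le_n|assumption].
  - destruct H as (z & E & H). eexists _, _.
    repeat split; [constructor; eassumption|apply le_n|assumption].
  - destruct (IHc1 _ _ H) as (s1 & t1 & E1 & L1 & H1).
    destruct (IHc2 _ _ H1) as (s2 & t2 & E2 & L2 & H2).
    exists s2, (t1 + t2)%nat. repeat split; [|simpl; lia|assumption].
    exact (exec_seq O s s1 s2 c1 c2 t1 t2 [] [] E1 E2).
  - destruct H as ([|] & E & H).
    + destruct (IHc1 _ _ H) as (s1 & t1 & E1 & L1 & H1).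
      eexists _, _. repeat split; [apply exec_if_true; eassumption|simpl; lia|assumption].
    + destruct (IHc2 _ _ H) as (s1 & t1 & E1 & L1 & H1).
      eexists _, _. repeat split; [apply exec_if_false; eassumption|simpl; lia|assumption].
Qed.

Lemma runs_weaken O c s n m (Q Q' : state -> Prop) :
  runs O c s n Q -> (n <= m)%nat -> (forall s', Q s' -> Q' s') -> runs O c s m Q'.
Proof.
  intros (s' & t & E & Ht & H) Hn HQ. exists s', t. repeat split; [assumption|lia|auto].
Qed.

Lemma runs_wp_le O c Q s n : wp c Q s -> (time_bound c <= n)%nat -> runs O c s n Q.
Proof. intros H Hn. exact (runs_weaken _ _ _ _ _ _ _ (runs_wp O c Q s H) Hn (fun _ h => h)). Qed.

Lemma runs_seq O c d s n m Q :
  runs O c s n (fun s' => runs O d s' m Q) -> runs O (c_seq c d) s (n + m) Q.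
Proof.
  intros (s1 & t1 & E1 & L1 & s2 & t2 & E2 & L2 & H).
  exists s2, (t1 + t2)%nat. repeat split; [|lia|assumption].
  exact (exec_seq O s s1 s2 c d t1 t2 [] [] E1 E2).
Qed.

Lemma runs_then O c d s n m k Q Q' :
  runs O c s n Q -> (forall s', Q s' -> runs O d s' m Q') -> (n + m <= k)%nat ->
  runs O (c_seq c d) s k Q'.
Proof.
  intros H H' Hk. apply (runs_weaken O _ s (n + m) k Q'); [|exact Hk|auto].
  apply runs_seq. eapply runs_weaken; [exact H|apply le_n|exact H'].
Qed.

Lemma runs_while O b c n m (I : nat -> state -> Prop) :
  (forall k s, (k < n)%nat -> I k s ->
     beval s b = Some true /\ runs O c s m (I (S k))) ->
  (forall s, I n s -> beval s b = Some false) ->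
  forall s, I 0%nat s ->
  runs O (c_while b c) s (n * (1 + bcost b + m) + (1 + bcost b)) (I n).
Proof.
  intros Hstep Hend.
  assert (H : forall j k s, (k + j = n)%nat -> I k s ->
    runs O (c_while b c) s (j * (1 + bcost b + m) + (1 + bcost b)) (I n)).
  { induction j as [|j IH]; intros k s Hk HI.
    - replace k with n in HI by lia. exists s, (1 + bcost b)%nat.
      repeat split; [apply exec_while_false; auto|lia|assumption].
    - destruct (Hstep k s ltac:(lia) HI) as (Hb & s1 & t1 & E1 & L1 & H1).
      destruct (IH (S k) s1 ltac:(lia) H1) as (s2 & t2 & E2 & L2 & H2).
      exists s2, (1 + bcost b + t1 + t2)%nat. repeat split; [|lia|assumption].
      exact (exec_while_true O s s1 s2 b c t1 t2 [] [] Hb E1 E2). }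
  intros s HI. apply (H n 0%nat); [lia|assumption].
Qed.

Definition c_for (i x : nat) (body : cmd) : cmd :=
  c_seq (c_iset i (i_const 0))
    (c_while (b_ltn (i_var i) (i_var x))
       (c_seq body (c_iset i (i_add (i_var i) (i_const 1))))).

(** The test and the increment cost 4 each, hence [m + 8] per round. The extra round in the bound
    pays for the initialization and the last test. *)
Lemma runs_for O i x body n m (I : nat -> state -> Prop) s :
  (forall k s', I k s' -> ireg s' i = k /\ ireg s' x = n) ->
  I 0%nat (set_ireg s i 0) ->
  (forall k s', (k < n)%nat -> I k s' ->
     runs O body s' m (fun s'' => ireg s'' i = k /\ I (S k) (set_ireg s'' i (S k)))) ->
  runs O (c_for i x body) s ((n + 1) * (m + 8)) (I n).
Proof.
  intros Hreg H0 Hstep.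
  eapply runs_weaken; [apply runs_seq|..].
  - apply runs_wp. simpl.
    apply (runs_while O _ _ n (m + 4) I); [| |assumption].
    + intros k s' Hk HI. destruct (Hreg k s' HI) as [E1 E2]. split.
      * simpl. rewrite E1, E2. apply Nat.ltb_lt in Hk. rewrite Hk. reflexivity.
      * apply runs_seq. eapply runs_weaken; [apply (Hstep k s' Hk HI)|apply le_n|].
        intros s'' [E H]. apply runs_wp. simpl. rewrite E, Nat.add_1_r. assumption.
    + intros s' HI. destruct (Hreg n s' HI) as [E1 E2]. simpl.
      rewrite E1, E2, Nat.ltb_irrefl. reflexivity.
  - simpl. lia.
  - auto.
Qed.

(** * Evaluation of expressions *)

Lemma reval_add s e f x y : reval s e = Some x -> reval s f = Some y ->
  reval s (r_add e f) = Some (x + y).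
Proof. simpl; intros -> ->; reflexivity. Qed.

Lemma reval_sub s e f x y : reval s e = Some x -> reval s f = Some y ->
  reval s (r_sub e f) = Some (x - y).
Proof. simpl; intros -> ->; reflexivity. Qed.

Lemma reval_mul s e f x y : reval s e = Some x -> reval s f = Some y ->
  reval s (r_mul e f) = Some (x * y).
Proof. simpl; intros -> ->; reflexivity. Qed.

Lemma reval_div s e f x y : reval s e = Some x -> reval s f = Some y -> y <> 0 ->
  reval s (r_div e f) = Some (x / y).
Proof.
  simpl; intros -> -> H; simpl. unfold div_op. destruct Req_dec_T; [contradiction|reflexivity].
Qed.

Lemma reval_cos s e x : reval s e = Some x -> 0 <= x <= 2 * PI ->
  reval s (r_cos e) = Some (cos x).
Proof.
  simpl; intros -> H; simpl. unfold angle_op.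
  destruct Rle_dec; [|lra]. destruct Rle_dec; [reflexivity|lra].
Qed.

Lemma reval_sin s e x : reval s e = Some x -> 0 <= x <= 2 * PI ->
  reval s (r_sin e) = Some (sin x).
Proof.
  simpl; intros -> H; simpl. unfold angle_op.
  destruct Rle_dec; [|lra]. destruct Rle_dec; [reflexivity|lra].
Qed.

Lemma beval_ltr s e f x y : reval s e = Some x -> reval s f = Some y ->
  beval s (b_ltr e f) = Some (if Rlt_dec x y then true else false).
Proof. simpl; intros -> ->; reflexivity. Qed.

Lemma beval_and s b c u v : beval s b = Some u -> beval s c = Some v ->
  beval s (b_and b c) = Some (andb u v).
Proof. simpl; intros -> ->; reflexivity. Qed.

Definition r_frac (p q : nat) : rexp := r_div (r_nat (i_const p)) (r_nat (i_const q)).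

Lemma reval_frac s p q : q <> 0%nat ->
  reval s (r_frac p q) = Some (IZR (Z.of_nat p) / IZR (Z.of_nat q)).
Proof.
  intros H. rewrite <- !INR_IZR_INZ. apply reval_div; try reflexivity.
  apply not_0_INR; assumption.
Qed.

Lemma reval_const s p : reval s (r_nat (i_const p)) = Some (IZR (Z.of_nat p)).
Proof. rewrite <- INR_IZR_INZ. reflexivity. Qed.

(** * Sorting in time [N^(3/2)] *)

(** Register [iN] and array [aInput] are number 0 by the convention of [run]. [iK] and [iOff] count
    loop rounds, [iRoot] is both the number and the length of the blocks, [iArg] is where a scan
    found its minimum, and [iLen] is the length of the instance written to [aBuffer]. *)
Local Notation iN := 0%nat.
Local Notation iK := 1%nat.
Local Notation iRoot := 2%nat.
Local Notation iOff := 3%nat.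
Local Notation iArg := 4%nat.
Local Notation iBase := 5%nat.
Local Notation iBlock := 6%nat.
Local Notation iLen := 7%nat.
Local Notation iWeight := 8%nat.

Local Notation rBound := 0%nat.
Local Notation rLast := 1%nat.
Local Notation rCur := 2%nat.
Local Notation rGap := 3%nat.

Local Notation aInput := 0%nat.
Local Notation aValue := 1%nat.
Local Notation aMin := 2%nat.
Local Notation aSorted := 3%nat.
Local Notation aBuffer := 4%nat.
Local Notation aShift1 := 5%nat.
Local Notation aShift2 := 6%nat.

Ltac st := cbn [ireg rreg iarr rarr set_ireg set_rreg set_iarr set_rarr upd Nat.eqb ieval] in *.

Ltac upd_cases :=
  unfold upd in *;
  repeat match goal with
  | |- context [Nat.eqb ?a ?b] => destruct (Nat.eqb_spec a b); try (exfalso; lia)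
  end.

Definition c_bound : cmd :=
  c_seq (c_rset rBound (r_nat (i_const 1)))
    (c_for iK iN (c_rset rBound (r_add (r_var rBound)
       (r_mul (r_get aInput (i_var iK)) (r_get aInput (i_var iK)))))).

Lemma runs_bound O s :
  runs O c_bound s (20 * (ireg s iN + 1)) (fun s' =>
    ireg s' iN = ireg s iN /\ rarr s' aInput = rarr s aInput /\
    1 <= rreg s' rBound /\
    forall i, (i < ireg s iN)%nat -> Rabs (rarr s aInput i) <= rreg s' rBound).
Proof.
  eapply runs_weaken.
  - apply runs_seq. apply runs_wp. simpl. eexists; split; [reflexivity|].
    apply (runs_for O _ _ _ (ireg s iN) 8 (fun k s' =>
      ireg s' iK = k /\ ireg s' iN = ireg s iN /\ rarr s' aInput = rarr s aInput /\
      1 <= rreg s' rBound /\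
      forall i, (i < k)%nat -> Rabs (rarr s aInput i) <= rreg s' rBound)).
    + tauto.
    + st. repeat split; try lra. intros; lia.
    + intros k s' Hk (E1 & E2 & E3 & H1 & H2).
      apply runs_wp_le; [|simpl; lia]. simpl. eexists; split; [reflexivity|]. st.
      rewrite E1, E3. set (x := rarr s aInput k).
      (* This square gives [Rabs x <= 1 + x * x], and the bound accumulated so far is at least 1. *)
      assert (0 <= (Rabs x - 1) * (Rabs x - 1)) by apply Rle_0_sqr.
      assert (0 <= x * x) by apply Rle_0_sqr.
      assert (Rabs x * Rabs x = x * x) by (rewrite <- Rabs_mult; apply Rabs_pos_eq; assumption).
      repeat split; try assumption; try lra.
      intros i Hi. destruct (Nat.eq_dec i k) as [->|]; [fold x; nra|].
      specialize (H2 i ltac:(lia)). lra.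
  - simpl. lia.
  - st. tauto.
Qed.

(** The squares are compared as reals because integer expressions have no multiplication. Linear
    search is cheap enough here. *)
Definition c_root : cmd :=
  c_seq (c_iset iRoot (i_const 0))
    (c_while (b_ltr (r_mul (r_nat (i_var iRoot)) (r_nat (i_var iRoot))) (r_nat (i_var iN)))
       (c_iset iRoot (i_add (i_var iRoot) (i_const 1)))).

Lemma runs_root O s :
  runs O c_root s (20 * (Nat.sqrt_up (ireg s iN) + 1)) (fun s' =>
    ireg s' iRoot = Nat.sqrt_up (ireg s iN) /\
    ireg s' iN = ireg s iN /\ rarr s' aInput = rarr s aInput /\
    rreg s' rBound = rreg s rBound).
Proof.
  set (n := ireg s iN).
  eapply runs_weaken.
  - apply runs_seq. apply runs_wp. simpl.
    apply (runs_while O _ _ (Nat.sqrt_up n) 4 (fun k s' =>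
      ireg s' iRoot = k /\ ireg s' iN = n /\ rarr s' aInput = rarr s aInput /\
      rreg s' rBound = rreg s rBound)).
    + intros k s' Hk (E1 & E2 & E3 & E4). split.
      * simpl. rewrite E1, E2. destruct Rlt_dec as [|H]; [reflexivity|].
        exfalso. apply H. rewrite <- mult_INR. apply lt_INR.
        apply Nat.sqrt_up_lt_square; lia.
      * apply runs_wp_le; [|simpl; lia]. simpl. st. repeat split; try assumption. lia.
    + intros s' (E1 & E2 & _). simpl. rewrite E1, E2.
      destruct Rlt_dec as [H|]; [|reflexivity].
      rewrite <- mult_INR in H. apply INR_lt in H.
      apply Nat.sqrt_up_lt_square in H; lia.
    + st. tauto.
  - simpl. lia.
  - cbv beta; tauto.
Qed.

Lemma map_upd_seq (f : nat -> R) k v :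
  map (upd f k v) (seq 0 (S k)) = map f (seq 0 k) ++ [v].
Proof.
  rewrite seq_S, map_app. simpl. f_equal.
  - apply map_ext_in. intros i Hi. apply in_seq in Hi. upd_cases. reflexivity.
  - upd_cases; reflexivity.
Qed.

(* The value [1] stands for infinity: the numbers sorted are at most [1 / 240]. *)
Definition next_value (last : R) (f : nat -> R) (n : nat) (v : R) (i : nat) : Prop :=
  (forall j, (j < n)%nat -> last < f j -> v <= f j) /\
  (v = 1 \/ ((i < n)%nat /\ v = f i /\ last < v < 1)).

Lemma next_value_ext l f g n v i : (forall j, (j < n)%nat -> f j = g j) ->
  next_value l f n v i -> next_value l g n v i.
Proof.
  intros E [H1 H2]. split.
  - intros j Hj Hl. rewrite <- E in * by assumption. auto.
  - destruct H2 as [|(Hi & -> & H)]; [tauto|]. right. rewrite <- E by assumption. tauto.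
Qed.

Section Sorting.

Variables (O : list R -> list R) (N q : nat) (X : nat -> R) (M : R).
Hypothesis M_pos : 1 <= M.
Hypothesis X_bound : forall i, (i < N)%nat -> Rabs (X i) <= M.
Hypothesis X_inj : forall i j, (i < N)%nat -> (j < N)%nat -> X i = X j -> i = j.
Hypothesis N_q : (N <= q * q)%nat.

Definition value (p : nat) : R := if (p <? N)%nat then X p / (240 * M) else 1.

Lemma value_range p : (p < N)%nat -> - (1 / 240) <= value p <= 1 / 240.
Proof.
  intros H. unfold value. specialize (X_bound p H). apply Nat.ltb_lt in H. rewrite H.
  pose proof (Rle_abs (X p)). pose proof (Rle_abs (- X p)) as H'. rewrite Rabs_Ropp in H'.
  split; apply (Rmult_le_reg_r (240 * M)); try lra; field_simplify; lra.
Qed.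

Lemma value_lt p : value p < 1 -> (p < N)%nat.
Proof. unfold value. destruct (Nat.ltb_spec p N); [auto|lra]. Qed.

Lemma value_inj p p' : value p < 1 -> value p = value p' -> p = p'.
Proof.
  intros H E. pose proof (value_lt p H) as H1. rewrite E in H.
  pose proof (value_lt p' H) as H2. apply X_inj; try assumption.
  unfold value in E. apply Nat.ltb_lt in H1, H2. rewrite H1, H2 in E.
  apply Rdiv_eq_reg_r in E; lra.
Qed.

(** Integer array 0 records the start [b * q] of each block, which integer expressions could not
    compute directly. The last blocks are padded with 1, that is, with infinity. *)
Definition c_fill : cmd :=
  c_seq (c_iset iBase (i_const 0))
    (c_for iK iRoot
      (c_seq (c_iput 0 (i_var iK) (i_var iBase))
        (c_for iOff iRoot
          (c_seq
            (c_if (b_ltn (i_var iBase) (i_var iN))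
               (c_rput aValue (i_var iBase)
                 (r_div (r_get aInput (i_var iBase))
                        (r_mul (r_nat (i_const 240)) (r_var rBound))))
               (c_rput aValue (i_var iBase) (r_nat (i_const 1))))
            (c_iset iBase (i_add (i_var iBase) (i_const 1))))))).

Lemma runs_fill s :
  ireg s iN = N -> ireg s iRoot = q -> rarr s aInput = X -> rreg s rBound = M ->
  runs O c_fill s (100 * ((q + 1) * (q + 1))) (fun s' =>
    ireg s' iN = N /\ ireg s' iRoot = q /\
    (forall b, (b < q)%nat -> iarr s' 0 b = (b * q)%nat) /\
    (forall p, (p < q * q)%nat -> rarr s' aValue p = value p)).
Proof.
  intros E1 E2 E3 E4.
  eapply runs_weaken.
  - apply runs_seq, runs_wp. simpl.
    apply (runs_for O _ _ _ q ((q + 1) * 50) (fun k s' =>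
      ireg s' iK = k /\ ireg s' iRoot = q /\ ireg s' iN = N /\ rarr s' aInput = X /\
      rreg s' rBound = M /\ ireg s' iBase = (k * q)%nat /\
      (forall b, (b < k)%nat -> iarr s' 0 b = (b * q)%nat) /\
      (forall p, (p < k * q)%nat -> rarr s' aValue p = value p))).
    + tauto.
    + st. repeat split; try assumption; intros; lia.
    + intros k s1 Hk (F1 & F2 & F3 & F4 & F5 & F6 & F7 & F8).
      eapply runs_weaken.
      * apply runs_seq, runs_wp. simpl.
        apply (runs_for O _ _ _ q 32 (fun j s' =>
          ireg s' iOff = j /\ ireg s' iRoot = q /\
          ireg s' iK = k /\ ireg s' iN = N /\ rarr s' aInput = X /\
          rreg s' rBound = M /\ ireg s' iBase = (k * q + j)%nat /\
          (forall b, (b < S k)%nat -> iarr s' 0 b = (b * q)%nat) /\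
          (forall p, (p < k * q + j)%nat -> rarr s' aValue p = value p))).
        -- tauto.
        -- st. repeat split; try assumption; try lia.
           ++ intros b Hb. upd_cases; [congruence|]. apply F7; lia.
           ++ intros p Hp. apply F8; lia.
        -- intros j s2 Hj (G1 & G2 & G3 & G4 & G5 & G6 & G7 & G8 & G9).
           apply runs_wp_le; [|simpl; lia].
           cbn [wp beval ieval]. rewrite G7, G4.
           eexists; split; [reflexivity|].
           destruct (Nat.ltb_spec (k * q + j) N) as [Hlt|Hge].
           ++ exists (value (k * q + j)). split.
              { rewrite (reval_div _ _ _ (X (k * q + j)) (240 * M)); [|..|lra].
                - unfold value. apply Nat.ltb_lt in Hlt. rewrite Hlt. reflexivity.
                - cbn [reval ieval]. rewrite G5, G7. reflexivity.
                - apply reval_mul; [apply reval_const|]. cbn [reval]. rewrite G6. reflexivity. }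
              st. rewrite G7. repeat split; try assumption; try lia.
              intros p Hp. upd_cases; [congruence|]. apply G9; lia.
           ++ exists (value (k * q + j)). split.
              { unfold value. apply Nat.ltb_ge in Hge. rewrite Hge. apply reval_const. }
              st. rewrite G7. repeat split; try assumption; try lia.
              intros p Hp. upd_cases; [congruence|]. apply G9; lia.
      * simpl. lia.
      * intros s3 (G1 & G2 & G3 & G4 & G5 & G6 & G7 & G8 & G9). st.
        repeat split; try assumption; try lia.
        intros p Hp. apply G9; lia.
  - simpl. lia.
  - cbv beta; tauto.
Qed.

(** The same scan serves twice: on [aValue] it runs through one block, on [aMin] through the table
    of block successors. *)
Definition c_scan (a : nat) : cmd :=
  c_seq (c_seq (c_rset rCur (r_nat (i_const 1))) (c_iset iArg (i_const 0)))
    (c_for iOff iRoot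
      (c_if (b_and (b_ltr (r_var rLast) (r_get a (i_add (i_var iBase) (i_var iOff))))
                   (b_ltr (r_get a (i_add (i_var iBase) (i_var iOff))) (r_var rCur)))
         (c_seq (c_rset rCur (r_get a (i_add (i_var iBase) (i_var iOff))))
                (c_iset iArg (i_var iOff)))
         c_skip)).

Definition scan_frame (s s' : state) : Prop :=
  (forall x, x <> iOff -> x <> iArg -> ireg s' x = ireg s x) /\
  (forall x, x <> rCur -> rreg s' x = rreg s x) /\
  iarr s' = iarr s /\ rarr s' = rarr s.

Lemma runs_scan a s :
  ireg s iRoot = q ->
  runs O (c_scan a) s (50 * (q + 1)) (fun s' => scan_frame s s' /\
    next_value (rreg s rLast) (fun j => rarr s a (ireg s iBase + j)) q
      (rreg s' rCur) (ireg s' iArg)).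
Proof.
  intros Eq. set (f := fun j => rarr s a (ireg s iBase + j)). set (l := rreg s rLast).
  eapply runs_weaken.
  - apply runs_seq, runs_wp. simpl. eexists; split; [reflexivity|].
    apply (runs_for O _ _ _ q 28 (fun k s' => ireg s' iOff = k /\ scan_frame s s' /\
      next_value l f k (rreg s' rCur) (ireg s' iArg))).
    + intros k s' (E & (F & _) & _). rewrite (F iRoot) by lia. tauto.
    + st. repeat split; try reflexivity; st.
      * intros x H1 H2. upd_cases; congruence.
      * intros x H1. upd_cases; congruence.
      * intros; lia.
      * left; reflexivity.
    + intros k s' Hk (E & (F1 & F2 & F3 & F4) & H1 & H2).
      assert (Ef : rarr s' a (ireg s' iBase + ireg s' iOff) = f k)
        by (rewrite E, F4, (F1 iBase) by lia; reflexivity).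
      assert (El : rreg s' rLast = l) by (rewrite F2 by lia; reflexivity).
      apply runs_wp_le; [|simpl; lia].
      cbn [wp]. eexists; split.
      { apply beval_and; apply beval_ltr; reflexivity. }
      cbn [ieval]. rewrite Ef, El.
      destruct (Rlt_dec l (f k)) as [Hl|Hl]; [destruct (Rlt_dec (f k) (rreg s' rCur)) as [Hc|Hc]|];
        cbn [andb].
      * eexists; split; [reflexivity|]. st. rewrite Ef, E.
        split; [reflexivity|]. split; [reflexivity|]. split; [repeat split|split]; st.
        -- intros x Hx1 Hx2. upd_cases; try congruence. apply F1; assumption.
        -- intros x Hx. upd_cases; try congruence. apply F2; assumption.
        -- assumption.
        -- assumption.
        -- intros j Hj Hlj. destruct (Nat.eq_dec j k) as [->|]; [lra|].
           specialize (H1 j ltac:(lia) Hlj). lra.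
        -- right. repeat split; try lia; try lra. all: destruct H2 as [->|(? & -> & ?)]; lra.
      * st. split; [assumption|]. split; [reflexivity|]. split; [repeat split|split]; st.
        -- intros x Hx1 Hx2. upd_cases; try congruence. apply F1; assumption.
        -- intros x Hx. apply F2; assumption.
        -- assumption.
        -- assumption.
        -- intros j Hj Hlj. destruct (Nat.eq_dec j k) as [->|]; [lra|].
           apply H1; [lia|assumption].
        -- destruct H2 as [H2|(H2 & H3 & H4)]; [left; assumption|right]. repeat split; auto; lra.
      * st. split; [assumption|]. split; [reflexivity|]. split; [repeat split|split]; st.
        -- intros x Hx1 Hx2. upd_cases; try congruence. apply F1; assumption.
        -- intros x Hx. apply F2; assumption.
        -- assumption.
        -- assumption.
        -- intros j Hj Hlj. destruct (Nat.eq_dec j k) as [->|]; [lra|].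
           apply H1; [lia|assumption].
        -- destruct H2 as [H2|(H2 & H3 & H4)]; [left; assumption|right]. repeat split; auto; lra.
  - simpl. lia.
  - st. intros s' (_ & H & H'). tauto.
Qed.

Definition block (b : nat) (j : nat) : R := value (b * q + j).

Lemma block_index p : (p < N)%nat -> exists b j, (b < q)%nat /\ (j < q)%nat /\ p = (b * q + j)%nat.
Proof.
  intros H. assert (q <> 0)%nat by nia. exists (p / q)%nat, (p mod q)%nat.
  pose proof (Nat.div_mod_eq p q). pose proof (Nat.mod_upper_bound p q ltac:(assumption)).
  repeat split; nia.
Qed.

Lemma block_index_inj b b' j j' : (j < q)%nat -> (j' < q)%nat ->
  (b * q + j = b' * q + j')%nat -> b = b'.
Proof. intros. nia. Qed.

(** The least table entry above [last] is the successor of [last] among all values. The numbers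
    being distinct, it comes from one block only, and the entries of the other blocks stay correct
    for the new bound [cur]; hence a single block needs a new scan. *)
Lemma select_step l last bm cur arg :
  (length l < N)%nat ->
  (forall p, (p < N)%nat -> value p <= last -> In (value p) l) ->
  (forall b, (b < q)%nat -> exists i, next_value last (block b) q (bm b) i) ->
  next_value last bm q cur arg ->
  (arg < q)%nat /\ last < cur < 1 /\ (exists p, (p < N)%nat /\ cur = value p) /\
  (forall p, (p < N)%nat -> value p <= cur -> value p = cur \/ In (value p) l) /\
  (forall b, (b < q)%nat -> b <> arg -> exists i, next_value cur (block b) q (bm b) i).
Proof.
  intros Hlen Hclosed Hbm [Hcur1 Hcur2].
  assert (Hlt1 : forall p, (p < N)%nat -> value p < 1).
  { intros p Hp. pose proof (value_range p Hp). lra. }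
  assert (Hmin : forall p, (p < N)%nat -> last < value p -> exists b j i, (b < q)%nat /\ (j < q)%nat /\
            p = (b * q + j)%nat /\ (i < q)%nat /\ bm b = block b i /\ last < bm b < 1 /\ bm b <= value p /\ cur <= bm b).
  { intros p Hp Hl. destruct (block_index p Hp) as (b & j & Hb & Hj & ->).
    destruct (Hbm b Hb) as (i & H1 & H2). specialize (H1 j Hj Hl).
    unfold block in H1 at 1. pose proof (Hlt1 _ Hp).
    destruct H2 as [H2|(Hi & H2 & H3)]; [lra|].
    exists b, j, i. specialize (Hcur1 b Hb (proj1 H3)). tauto. }
  (* A counting argument: otherwise the [N] distinct values would all belong to [l], which is
     shorter than [N]. *)
  assert (Hex : exists p, (p < N)%nat /\ last < value p).
  { destruct (classic (exists p, (p < N)%nat /\ last < value p)) as [|Hn]; [assumption|exfalso].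
    assert (Hincl : incl (map value (seq 0 N)) l).
    { intros y Hy. apply in_map_iff in Hy as (p & <- & Hp). apply in_seq in Hp.
      apply Hclosed; [lia|]. apply Rnot_lt_le. intros H. apply Hn. exists p. split; [lia|assumption]. }
    apply NoDup_incl_length in Hincl.
    - rewrite length_map, length_seq in Hincl. lia.
    - apply NoDup_map_NoDup_ForallPairs; [|apply seq_NoDup].
      intros a b Ha _. apply in_seq in Ha. apply value_inj, Hlt1; lia. }
  destruct Hex as (p0 & Hp0 & Hl0).
  destruct (Hmin p0 Hp0 Hl0) as (b0 & _ & _ & Hb0 & _ & _ & _ & _ & Hb0r & _ & Hb0c).
  destruct Hcur2 as [->|(Harg & Ecur & Hcr)]; [lra|].
  destruct (Hbm arg Harg) as (i0 & Ha1 & Ha2).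
  destruct Ha2 as [Ha2|(Hi0 & Ha2 & _)]; [lra|].
  assert (Hcv : cur = value (arg * q + i0)) by (rewrite Ecur; exact Ha2).
  split; [assumption|]. split; [assumption|]. split; [|split].
  - exists (arg * q + i0)%nat. split; [|assumption]. apply value_lt. lra.
  - intros p Hp Hle. destruct (Rle_dec (value p) last) as [H|H]; [right; auto|left].
    destruct (Hmin p Hp ltac:(lra)) as (b & j & i & _ & _ & _ & _ & _ & _ & H1 & H2). lra.
  - intros b Hb Hne. destruct (Hbm b Hb) as (i & H1 & H2). exists i. split.
    + intros j Hj Hl. apply H1; [assumption|lra].
    + destruct H2 as [H2|(Hi & H2 & H3)]; [tauto|right].
      split; [assumption|]. split; [assumption|]. split; [|lra].
      specialize (Hcur1 b Hb (proj1 H3)).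
      (* An entry of another block equal to [cur] would be the same value at two indices. *)
      destruct Hcur1 as [|E]; [assumption|exfalso].
      apply Hne, (block_index_inj b arg i i0 Hi Hi0).
      unfold block in H2. apply value_inj; lra.
Qed.

Definition prepared (s : state) : Prop :=
  ireg s iN = N /\ ireg s iRoot = q /\
  (forall b, (b < q)%nat -> iarr s 0 b = (b * q)%nat) /\
  (forall p, (p < q * q)%nat -> rarr s aValue p = value p).

Definition c_minima : cmd :=
  c_seq (c_rset rLast (r_sub (r_nat (i_const 0)) (r_nat (i_const 1))))
    (c_for iK iRoot
      (c_seq (c_iset iBase (i_get 0 (i_var iK)))
        (c_seq (c_scan aValue) (c_rput aMin (i_var iK) (r_var rCur))))).

Lemma runs_scan_block s b :
  prepared s -> (b < q)%nat -> ireg s iBase = (b * q)%nat ->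
  runs O (c_scan aValue) s (50 * (q + 1)) (fun s' => scan_frame s s' /\
    next_value (rreg s rLast) (block b) q (rreg s' rCur) (ireg s' iArg)).
Proof.
  intros (P1 & P2 & P3 & P4) Hb E.
  eapply runs_weaken; [apply (runs_scan aValue s P2)|apply le_n|].
  cbv beta. intros s' [F H]. split; [assumption|].
  eapply next_value_ext; [|exact H]. intros j Hj. cbv beta. rewrite E.
  apply P4. nia.
Qed.

Lemma prepared_frame s s' : prepared s -> scan_frame s s' -> prepared s'.
Proof.
  intros (P1 & P2 & P3 & P4) (F1 & F2 & F3 & F4). unfold prepared.
  rewrite F3, F4, !F1 by lia. tauto.
Qed.

Lemma runs_minima s :
  prepared s ->
  runs O c_minima s (100 * ((q + 1) * (q + 1))) (fun s' => prepared s' /\ rreg s' rLast = - 1 /\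
    forall b, (b < q)%nat -> exists i, next_value (- 1) (block b) q (rarr s' aMin b) i).
Proof.
  intros HP. eapply runs_weaken.
  - apply runs_seq, runs_wp. simpl. eexists; split; [reflexivity|].
    apply (runs_for O _ _ _ q (3 + (50 * (q + 1) + 3)) (fun k s' => ireg s' iK = k /\ prepared s' /\ rreg s' rLast = - 1 /\
      forall b, (b < k)%nat -> exists i, next_value (- 1) (block b) q (rarr s' aMin b) i)).
    + intros k s' (E & (P1 & P2 & _) & _). tauto.
    + destruct HP as (P1 & P2 & P3 & P4). unfold prepared. st.
      repeat split; try assumption; [lra|]. intros; lia.
    + intros k s1 Hk (E & P & El & Hb). apply runs_seq, runs_wp_le; [|simpl; lia].
      cbn [wp]. pose proof P as (P1 & P2 & P3 & P4).
      apply runs_seq. eapply runs_weaken; [apply (runs_scan_block _ k)|apply le_n|].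
      * unfold prepared; st; tauto.
      * assumption.
      * st. rewrite E. apply P3; assumption.
      * cbv beta. intros s2 [F H]. apply runs_wp_le; [|simpl; lia].
        simpl. eexists; split; [reflexivity|].
        assert (P' : prepared s2)
          by (apply (prepared_frame _ _ ) with (2 := F); unfold prepared; st; tauto).
        destruct F as (F1 & F2 & F3 & F4).
        rewrite (F1 iK) by lia. st. rewrite E. split; [reflexivity|].
        split; [reflexivity|]. split; [exact P'|]. split.
        -- rewrite F2 by lia. assumption.
        -- intros b Hbk. upd_cases.
           ++ subst b. rewrite El in H. eexists; exact H.
           ++ rewrite F4. apply Hb. lia.
  - simpl. nia.
  - cbv beta. tauto.
Qed.

(** [rGap] ends as the minimum of [1 / 480] and a third of the least gap between consecutive
    numbers. The first round compares with the sentinel -1, which is too far away to matter.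
    [iBlock] saves [iArg] because the second scan overwrites it. *)
Definition c_select : cmd :=
  c_seq (c_rset rGap (r_frac 1 480))
    (c_for iK iN
      (c_seq (c_iset iBase (i_const 0))
        (c_seq (c_scan aMin)
          (c_seq
            (c_seq (c_rput aSorted (i_var iK) (r_var rCur))
              (c_seq
                (c_if (b_ltr (r_sub (r_var rCur) (r_var rLast))
                             (r_mul (r_nat (i_const 3)) (r_var rGap)))
                   (c_rset rGap (r_div (r_sub (r_var rCur) (r_var rLast)) (r_nat (i_const 3))))
                   c_skip)
                (c_seq (c_rset rLast (r_var rCur))
                  (c_seq (c_iset iBlock (i_var iArg))
                     (c_iset iBase (i_get 0 (i_var iArg)))))))
            (c_seq (c_scan aValue)
               (c_rput aMin (i_var iBlock) (r_var rCur))))))).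

Definition selected (k : nat) (s : state) : Prop :=
  let l := map (rarr s aSorted) (seq 0 k) in
  prepared s /\ - 1 <= rreg s rLast /\
  (forall y, In y l -> y <= rreg s rLast) /\
  (forall p, (p < N)%nat -> value p <= rreg s rLast -> In (value p) l) /\
  (forall y, In y l -> exists p, (p < N)%nat /\ y = value p) /\
  0 < rreg s rGap <= 1 / 480 /\
  StronglySorted (fun u v => u + 3 * rreg s rGap <= v) l /\
  (forall b, (b < q)%nat -> exists i, next_value (rreg s rLast) (block b) q (rarr s aMin b) i).

Lemma runs_select s :
  prepared s -> rreg s rLast = - 1 ->
  (forall b, (b < q)%nat -> exists i, next_value (- 1) (block b) q (rarr s aMin b) i) ->
  runs O c_select s (200 * ((N + 1) * (q + 1))) (fun s' =>
    let l := map (rarr s' aSorted) (seq 0 N) in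
    ireg s' iN = N /\ 0 < rreg s' rGap <= 1 / 480 /\
    StronglySorted (fun u v => u + 3 * rreg s' rGap <= v) l /\
    (forall y, In y l <-> exists p, (p < N)%nat /\ y = value p)).
Proof.
  intros HP Hlast Hmin. eapply runs_weaken.
  - apply runs_seq, runs_wp. cbn [wp]. eexists; split; [apply reval_frac; lia|].
    apply (runs_for O _ _ _ N (2 + (50 * (q + 1) + (30 + (50 * (q + 1) + 3))))
      (fun k s' => ireg s' iK = k /\ selected k s')).
    + intros k s' (E & (P1 & P2 & _) & _). tauto.
    + split; [reflexivity|]. unfold selected. simpl seq. simpl map. cbv zeta.
      split; [exact HP|]. st. rewrite Hlast. split; [lra|].
      split; [intros y []|]. split.
      { intros p Hp Hv. pose proof (value_range p Hp); lra. }
      split; [intros y []|]. split; [simpl; lra|]. split; [constructor|assumption].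
    + intros k s1 Hk (E & P & Hl & Hmax & Hclosed & Hincl & Hgap & Hsorted & Hbm).
      pose proof P as (P1 & P2 & P3 & P4).
      apply runs_seq, runs_wp_le; [|simpl; lia]. cbn [wp].
      apply runs_seq. eapply runs_weaken; [apply runs_scan; exact P2|apply le_n|].
      cbv beta. intros s2 [F H].
      assert (P' : prepared s2)
        by (apply (prepared_frame _ _ ) with (2 := F); unfold prepared; st; tauto).
      destruct F as (F1 & F2 & F3 & F4). st. cbn [Nat.add] in H.
      destruct (select_step (map (rarr s1 aSorted) (seq 0 k)) (rreg s1 rLast) (rarr s1 aMin)
                  (rreg s2 rCur) (ireg s2 iArg)) as (Harg & Hcur & Hval & Hclosed' & Hbm');
        [rewrite length_map, length_seq; lia|assumption|assumption|exact H|].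
      assert (E2 : ireg s2 iK = k) by (rewrite F1 by lia; assumption).
      assert (El2 : rreg s2 rLast = rreg s1 rLast) by (apply F2; lia).
      assert (Eg2 : rreg s2 rGap = rreg s1 rGap) by (apply F2; lia).
      apply runs_seq, runs_wp_le; [|simpl; lia].
      cbn [wp]. eexists; split; [reflexivity|].
      eexists; split; [apply beval_ltr; [apply reval_sub; reflexivity|
        apply reval_mul; [apply reval_const|reflexivity]]|]. st. simpl IZR.
      rewrite El2, Eg2.
      set (s3 := set_rarr s2 aSorted (ireg s2 iK) (rreg s2 rCur)).
      (* The rest of the round is treated once for both outcomes of the gap test; all it needs from
         them is a positive gap that did not grow and is at most a third of the last difference. *)
      assert (Hgo : forall s4, 
        (forall x, ireg s4 x = ireg s2 x) -> (forall x, x <> rGap -> rreg s4 x = rreg s2 x) ->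
        iarr s4 = iarr s2 -> rarr s4 = rarr s3 ->
        0 < rreg s4 rGap <= rreg s1 rGap -> 3 * rreg s4 rGap <= rreg s2 rCur - rreg s1 rLast ->
        wp (c_seq (c_rset rLast (r_var rCur))
                  (c_seq (c_iset iBlock (i_var iArg))
                     (c_iset iBase (i_get 0 (i_var iArg)))))
          (fun s5 => runs O (c_seq (c_scan aValue) (c_rput aMin (i_var iBlock) (r_var rCur))) s5
             (50 * (q + 1) + 3) (fun s6 => ireg s6 iK = k /\
               ireg (set_ireg s6 iK (S k)) iK = S k /\ selected (S k) (set_ireg s6 iK (S k)))) s4).
      { intros s4 Q1 Q2 Q3 Q4 Q5 Q6. simpl. eexists; split; [reflexivity|].
        assert (P4' : forall x v w z, prepared (set_ireg (set_ireg (set_rreg s4 x v) iBlock w) iBase z)).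
        { intros. unfold prepared. destruct P' as (P1' & P2' & P3' & P4').
          st. rewrite Q3, Q4, !Q1. subst s3. st. tauto. }
        apply runs_seq. eapply runs_weaken;
          [apply (runs_scan_block _ (ireg s2 iArg))|apply le_n|].
        - apply P4'; exact 0%nat.
        - assumption.
        - st. rewrite Q1, Q3. apply P'; assumption.
        - cbv beta. intros s5 [F' H']. st. rewrite Q1, (Q2 rCur) in * by lia.
          apply runs_wp_le; [|simpl; lia].
          simpl. eexists; split; [reflexivity|].
          assert (P'' : prepared s5)
            by (apply (prepared_frame _ _ ) with (2 := F'); apply P4'; exact 0%nat).
          destruct F' as (F1' & F2' & F3' & F4'). st.
          split; [rewrite F1' by lia; st; rewrite Q1; assumption|].
          split; [reflexivity|].
          assert (ES : rarr s5 aSorted = upd (rarr s1 aSorted) k (rreg s2 rCur)).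
          { rewrite F4', Q4. subst s3. st. rewrite F4, E2. reflexivity. }
          assert (EM : rarr s5 aMin = rarr s1 aMin).
          { rewrite F4', Q4. subst s3. st. rewrite F4. reflexivity. }
          assert (EL : rreg s5 rLast = rreg s2 rCur) by (rewrite F2' by lia; reflexivity).
          assert (EG : rreg s5 rGap = rreg s4 rGap) by (rewrite F2' by lia; reflexivity).
          assert (EB : ireg s5 iBlock = ireg s2 iArg) by (rewrite F1' by lia; reflexivity).
          unfold selected. cbv zeta. split; [exact P''|]. st.
          rewrite ES, EL, EG, EB, EM, map_upd_seq.
          split; [lra|]. split; [|split; [|split; [|split; [|split]]]].
          + intros y Hy. apply in_app_iff in Hy as [Hy|[<-|[]]]; [|lra].
            specialize (Hmax y Hy). lra.
          + intros p Hp Hv. apply in_app_iff.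
            destruct (Hclosed' p Hp Hv) as [->|]; [right; left; reflexivity|tauto].
          + intros y Hy. apply in_app_iff in Hy as [Hy|[<-|[]]]; auto.
          + lra.
          + apply StronglySorted_app; [|repeat constructor|].
            * eapply StronglySorted_weaken; [|exact Hsorted]. cbv beta. intros; lra.
            * intros x y Hx [<-|[]]. specialize (Hmax x Hx). lra.
          + intros b Hb. upd_cases.
            * subst b. eexists; exact H'.
            * apply Hbm'; assumption. }
      destruct (Rlt_dec _ _) as [Hlt|Hge].
      * eexists; split.
        { apply reval_div; [apply reval_sub; reflexivity|apply reval_const|simpl; lra]. }
        apply Hgo; subst s3; st; try reflexivity; try (simpl; rewrite El2; lra).
        intros x Hx. upd_cases; reflexivity.
      * apply Hgo; subst s3; st; try reflexivity; rewrite Eg2; lra.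
  - simpl. nia.
  - cbv beta zeta. intros s' (E & P & Hl & Hmax & Hclosed & Hincl & Hgap & Hsorted & Hbm).
    split; [apply P|]. split; [assumption|]. split; [assumption|].
    intros y; split; [apply Hincl|]. intros (p & Hp & ->).
    destruct (Rle_dec (value p) (rreg s' rLast)) as [|Hn]; [auto|exfalso].
    (* If the value at [p] were missed, the [N] distinct outputs would fit among the values of fewer
       than [N] indices. *)
    assert (Hincl' : incl (map (rarr s' aSorted) (seq 0 N)) (map value (remove Nat.eq_dec p (seq 0 N)))).
    { intros z Hz. destruct (Hincl z Hz) as (p' & Hp' & ->). apply in_map, in_in_remove.
      - intros ->. apply Hn, Hmax, Hz.
      - apply in_seq; lia. }
    apply NoDup_incl_length in Hincl'.
    + rewrite !length_map, length_seq in Hincl'.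
      pose proof (remove_length_lt Nat.eq_dec (seq 0 N) p). rewrite length_seq in H.
      assert (In p (seq 0 N)) by (apply in_seq; lia). specialize (H H0). lia.
    + apply (StronglySorted_NoDup (3 * rreg s' rGap)); [lra|assumption].
Qed.

End Sorting.

(** * Writing the instance *)

Definition c_shift : cmd :=
  c_for iK iN
    (c_if (b_ltr (r_nat (i_const 0)) (r_get aSorted (i_var iK)))
       (c_seq (c_rput aShift1 (i_var iK) (r_get aSorted (i_var iK)))
              (c_rput aShift2 (i_var iK) (r_add (r_get aSorted (i_var iK)) (r_frac 1 60))))
       (c_seq (c_rput aShift1 (i_var iK) (r_sub (r_get aSorted (i_var iK)) (r_frac 1 30)))
              (c_rput aShift2 (i_var iK) (r_get aSorted (i_var iK))))).

Lemma runs_shift O s :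
  runs O c_shift s (60 * (ireg s iN + 1)) (fun s' =>
    ireg s' iN = ireg s iN /\ rreg s' rGap = rreg s rGap /\
    forall k, (k < ireg s iN)%nat ->
      rarr s' aShift1 k = shift1 (rarr s aSorted k) /\
      rarr s' aShift2 k = shift2 (rarr s aSorted k)).
Proof.
  eapply runs_weaken.
  - apply (runs_for O _ _ _ (ireg s iN) 50 (fun k s' =>
      ireg s' iK = k /\ ireg s' iN = ireg s iN /\ rreg s' rGap = rreg s rGap /\
      rarr s' aSorted = rarr s aSorted /\
      forall j, (j < k)%nat ->
        rarr s' aShift1 j = shift1 (rarr s aSorted j) /\
        rarr s' aShift2 j = shift2 (rarr s aSorted j))).
    + tauto.
    + st. repeat split; intros; lia.
    + intros k s1 Hk (E1 & E2 & E3 & E4 & H). apply runs_wp_le; [|simpl; lia].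
      cbn [wp]. eexists; split; [apply beval_ltr; [apply reval_const|reflexivity]|].
      cbn [ieval]. rewrite E1, E4. change (IZR (Z.of_nat 0)) with 0.
      unfold shift1, shift2 in *.
      destruct (Rlt_dec 0 (rarr s aSorted k)) as [Hpos|Hneg].
      * eexists; split; [reflexivity|].
        eexists; split; [apply reval_add; [reflexivity|apply reval_frac; lia]|].
        simpl Z.of_nat. st. rewrite E1, E4.
        repeat split; try assumption; upd_cases; try (apply H; lia);
          subst j; destruct Rlt_dec; tauto || reflexivity.
      * eexists; split; [apply reval_sub; [reflexivity|apply reval_frac; lia]|].
        eexists; split; [reflexivity|].
        simpl Z.of_nat. st. rewrite E1, E4.
        repeat split; try assumption; upd_cases; try (apply H; lia);
          subst j; destruct Rlt_dec; tauto || reflexivity.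
  - lia.
  - cbv beta. tauto.
Qed.

(** * Frames and the emission of lists of reals *)

Definition frame (J : list nat) (s s' : state) : Prop :=
  (forall x, ~ In x J -> ireg s' x = ireg s x) /\
  rreg s' = rreg s /\
  (forall a, a <> aBuffer -> rarr s' a = rarr s a).

Lemma frame_refl J s : frame J s s.
Proof. repeat split. Qed.

Lemma frame_trans J s s' s'' : frame J s s' -> frame J s' s'' -> frame J s s''.
Proof.
  intros (F1 & F2 & F3) (G1 & G2 & G3). repeat split; intros.
  - rewrite G1, F1; auto.
  - congruence.
  - rewrite G3, F3; auto.
Qed.

Lemma frame_incl J J' s s' : incl J J' -> frame J s s' -> frame J' s s'.
Proof. intros H (F1 & F2 & F3). repeat split; auto. Qed.

(** Under sequencing, costs add and outputs concatenate, so the correctness of the writer becomes an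
    equation between lists. *)
Definition emits (O : list R -> list R) (J : list nat) (c : cmd) (s : state) (n : nat)
    (l : list R) : Prop :=
  runs O c s n (fun s' => frame J s s' /\
    fetch s' aBuffer iLen = fetch s aBuffer iLen ++ l).

Lemma emits_weaken O J J' c s n m l l' :
  emits O J c s n l -> incl J J' -> (n <= m)%nat -> l = l' -> emits O J' c s m l'.
Proof.
  intros H HJ Hn <-. eapply runs_weaken; [exact H|assumption|].
  cbv beta. intros s' [F E]. split; [|assumption]. exact (frame_incl _ _ _ _ HJ F).
Qed.

Lemma emits_seq O J c d s n m l k :
  emits O J c s n l -> (forall s', frame J s s' -> emits O J d s' m k) ->
  emits O J (c_seq c d) s (n + m) (l ++ k).
Proof.
  intros H H'. apply runs_seq. eapply runs_weaken; [exact H|apply le_n|].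
  cbv beta. intros s1 [F E]. eapply runs_weaken; [exact (H' s1 F)|apply le_n|].
  cbv beta. intros s2 [F' E']. split; [exact (frame_trans _ _ _ _ F F')|].
  rewrite E', E, app_assoc. reflexivity.
Qed.

Lemma emits_for O x body s m (f : nat -> list R) :
  x <> iK -> x <> iLen ->
  (forall k s', (k < ireg s x)%nat -> frame [iK; iLen] s s' -> ireg s' iK = k ->
     emits O [iLen] body s' m (f k)) ->
  emits O [iK; iLen] (c_for iK x body) s ((ireg s x + 1) * (m + 8))
    (flat_map f (seq 0 (ireg s x))).
Proof.
  intros Hx1 Hx2 Hbody.
  eapply runs_weaken.
  - apply (runs_for O _ _ _ (ireg s x) m (fun k s' => ireg s' iK = k /\ frame [iK; iLen] s s' /\
      fetch s' aBuffer iLen = fetch s aBuffer iLen ++ flat_map f (seq 0 k))).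
    + intros k s' (E & (F & _) & _). split; [assumption|]. apply F. simpl; intuition.
    + split; [reflexivity|]. split.
      * repeat split. intros y Hy. st. upd_cases; [|reflexivity]. exfalso; apply Hy; simpl; auto.
      * simpl. rewrite app_nil_r. reflexivity.
    + intros k s1 Hk (E & F & H).
      eapply runs_weaken; [exact (Hbody k s1 Hk F E)|apply le_n|].
      cbv beta. intros s2 (G & H'). pose proof G as (G1 & G2 & G3).
      split; [rewrite G1; [assumption|simpl; lia]|]. split; [reflexivity|]. split.
      * apply (frame_trans _ _ _ _ F). repeat split; [|assumption|assumption].
        intros y Hy. st. upd_cases; [exfalso; apply Hy; simpl; auto|].
        apply G1. simpl in *; tauto.
      * change (fetch (set_ireg s2 iK (S k)) aBuffer iLen) with (fetch s2 aBuffer iLen).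
        rewrite H', H, seq_S, flat_map_app. simpl. rewrite app_nil_r, app_assoc. reflexivity.
  - apply le_n.
  - cbv beta. tauto.
Qed.

Definition c_push (e : rexp) : cmd :=
  c_seq (c_rput aBuffer (i_var iLen) e) (c_iset iLen (i_add (i_var iLen) (i_const 1))).

Lemma emits_push O s e v :
  reval s e = Some v -> emits O [iLen] (c_push e) s (rcost e + 6) [v].
Proof.
  intros E. apply runs_wp_le; [|simpl; lia]. simpl. exists v; split; [assumption|].
  split.
  - repeat split; intros; st; upd_cases; try reflexivity; exfalso; simpl in *; tauto || auto.
  - unfold fetch. st. rewrite Nat.add_1_r. apply map_upd_seq.
Qed.

Definition c_push_point (e f : rexp) : cmd := c_seq (c_push e) (c_push f).

Definition coordinates (l : list point) : list R := flat_map (fun p => [fst p; snd p]) l.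

Lemma coordinates_app l m : coordinates (l ++ m) = coordinates l ++ coordinates m.
Proof. apply flat_map_app. Qed.

Lemma coordinates_flat_map {A} (f : A -> list point) l :
  coordinates (flat_map f l) = flat_map (fun x => coordinates (f x)) l.
Proof.
  induction l as [|a l IH]; [reflexivity|].
  simpl. rewrite coordinates_app, IH. reflexivity.
Qed.

Lemma emits_push_point O s e f p :
  (forall s', frame [iLen] s s' -> reval s' e = Some (fst p) /\ reval s' f = Some (snd p)) ->
  emits O [iLen] (c_push_point e f) s (rcost e + rcost f + 12) (coordinates [p]).
Proof.
  intros H. eapply emits_weaken.
  - apply emits_seq.
    + apply emits_push. apply H, frame_refl.
    + intros s' F. apply emits_push. apply H, F.
  - apply incl_refl.
  - lia.
  - reflexivity.
Qed.

Lemma map_as_flat_map {A B} (f : A -> B) l : map f l = flat_map (fun x => [f x]) l.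
Proof. induction l; simpl; congruence. Qed.

Lemma map_flat_map {A B C} (f : B -> C) (g : A -> list B) l :
  map f (flat_map g l) = flat_map (fun x => map f (g x)) l.
Proof. induction l; simpl; [reflexivity|]. rewrite map_app, IHl. reflexivity. Qed.

Lemma flat_map_of_map {A B C} (f : A -> B) (g : B -> list C) l :
  flat_map g (map f l) = flat_map (fun x => g (f x)) l.
Proof. induction l; simpl; congruence. Qed.

(** This matches the reversed list in [sum_angles] with the index computed by [e_shift2_rev]. *)
Lemma rev_seq_0 n : rev (seq 0 n) = map (fun k => (n - 1 - k)%nat) (seq 0 n).
Proof.
  apply (nth_ext _ _ 0%nat 0%nat).
  - rewrite length_rev, length_map; reflexivity.
  - intros i Hi. rewrite length_rev, length_seq in Hi.
    rewrite rev_nth by (rewrite length_seq; assumption). rewrite length_seq.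
    rewrite (nth_indep (map _ _) _ (n - 1 - 0)%nat) by (rewrite length_map, length_seq; assumption).
    rewrite (map_nth (fun k => (n - 1 - k)%nat)), !seq_nth by lia. lia.
Qed.

Section Emission.

Variables (O : list R -> list R) (N : nat) (Y : nat -> R) (w : R).
Hypothesis w_range : 0 < w <= 1 / 480.
Hypothesis Y_range : forall k, (k < N)%nat -> - (1 / 240) <= Y k <= 1 / 240.

Let L := map Y (seq 0 N).
Let W := (N + N + 3)%nat.

Definition ready (s : state) : Prop :=
  ireg s iN = N /\ ireg s iWeight = W /\ rreg s rGap = w /\
  forall k, (k < N)%nat ->
    rarr s aShift1 k = shift1 (Y k) /\ rarr s aShift2 k = shift2 (Y k).

Lemma ready_frame s s' : ready s -> frame [iK; iLen] s s' -> ready s'.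
Proof.
  intros (H1 & H2 & H3 & H4) (F1 & F2 & F3). unfold ready.
  rewrite F2, !F3, !F1 by (simpl; lia). tauto.
Qed.

Lemma frame_len s s' : frame [iLen] s s' -> frame [iK; iLen] s s' /\ ireg s' iK = ireg s iK.
Proof.
  intros F. split.
  - revert F. apply frame_incl. intros x Hx. right; assumption.
  - apply F. simpl; lia.
Qed.

Definition c_dir (e : rexp) : cmd := c_push_point (r_cos e) (r_sin e).

(** Sine and cosine are defined only on [[0, 2 * PI]], and [4 < 2 * PI]. *)
Lemma emits_dir k s e a :
  ready s -> ireg s iK = k ->
  (forall s', ready s' -> ireg s' iK = k -> reval s' e = Some a) -> 0 <= a <= 4 ->
  emits O [iLen] (c_dir e) s (2 * rcost e + 14) (coordinates [dir a]).
Proof.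
  intros Hr Hk He Ha. pose proof pi_gt_3.
  eapply emits_weaken; [apply emits_push_point|apply incl_refl|simpl; lia|reflexivity].
  intros s' F. apply frame_len in F as [F E].
  assert (E' : reval s' e = Some a)
    by (apply He; [exact (ready_frame _ _ Hr F)|congruence]).
  split; [apply reval_cos|apply reval_sin]; (exact E' || lra).
Qed.

Lemma emits_cat J c d s n m p r :
  ready s -> incl J [iK; iLen] ->
  emits O J c s n (coordinates p) ->
  (forall s', ready s' -> (~ In iK J -> ireg s' iK = ireg s iK) -> emits O J d s' m (coordinates r)) ->
  emits O J (c_seq c d) s (n + m) (coordinates (p ++ r)).
Proof.
  intros Hr HJ H H'. rewrite coordinates_app. apply emits_seq; [assumption|].
  intros s' F. apply H'.
  - exact (ready_frame _ _ Hr (frame_incl _ _ _ _ HJ F)).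
  - apply F.
Qed.

Lemma emits_loop x n body m (f : nat -> list point) s :
  ready s -> x <> iK -> x <> iLen -> ireg s x = n ->
  (forall k s', (k < n)%nat -> ready s' -> ireg s' iK = k ->
     emits O [iLen] body s' m (coordinates (f k))) ->
  emits O [iK; iLen] (c_for iK x body) s ((n + 1) * (m + 8))
    (coordinates (flat_map f (seq 0 n))).
Proof.
  intros Hr Hx1 Hx2 <- Hbody. rewrite coordinates_flat_map.
  apply emits_for; [assumption|assumption|].
  intros k s' Hk F E. apply Hbody; [assumption| |assumption].
  exact (ready_frame _ _ Hr F).
Qed.

Lemma emits_single k s e a :
  ready s -> ireg s iK = k ->
  (forall s', ready s' -> ireg s' iK = k -> reval s' e = Some a) -> 0 <= a <= 4 ->
  emits O [iK; iLen] (c_dir e) s (2 * rcost e + 14) (coordinates [dir a]).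
Proof.
  intros. eapply emits_weaken; [eapply emits_dir; eassumption| |apply le_n|reflexivity].
  intros x Hx; right; assumption.
Qed.

Definition e_shift1 : rexp := r_get aShift1 (i_var iK).
Definition e_shift2 : rexp := r_get aShift2 (i_var iK).
Definition e_shift2_rev : rexp :=
  r_get aShift2 (i_sub (i_sub (i_var iN) (i_const 1)) (i_var iK)).

Definition c_positions : cmd :=
  c_seq (c_seq (c_dir (r_frac 11 10)) (c_dir (r_add (r_frac 11 10) (r_var rGap))))
    (c_for iK iN
      (c_seq (c_dir (r_add (r_frac 3 2) e_shift1))
             (c_dir (r_add (r_add (r_frac 3 2) e_shift1) (r_var rGap))))).

Definition c_sums : cmd :=
  c_seq (c_seq (c_dir (r_frac 27 10)) (c_seq (c_dir (r_frac 28 10)) (c_dir (r_frac 29 10))))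
    (c_seq (c_for iK iN (c_dir (r_sub (r_nat (i_const 3)) e_shift2_rev)))
           (c_for iK iN (c_dir (r_sub (r_frac 61 20) e_shift2_rev)))).

Definition e_low : rexp :=
  r_div (r_nat (i_add (i_var iK) (i_const 1)))
        (r_mul (r_nat (i_const 5)) (r_nat (i_var iWeight))).

(** The sine and cosine of 0 are evaluated so that the output is literally
    [lerp (dir 0) (dir w)]. *)
Definition c_chord (e : rexp) : cmd :=
  c_push_point
    (r_add (r_mul (r_sub (r_nat (i_const 1)) e) (r_cos (r_nat (i_const 0))))
           (r_mul e (r_cos (r_var rGap))))
    (r_add (r_mul (r_sub (r_nat (i_const 1)) e) (r_sin (r_nat (i_const 0))))
           (r_mul e (r_sin (r_var rGap)))).

Definition c_chords : cmd :=
  c_seq (c_for iK iWeight (c_chord e_low))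
        (c_for iK iWeight (c_chord (r_sub (r_nat (i_const 1)) e_low))).

Definition c_points : cmd :=
  c_seq (c_seq (c_dir (r_frac 16 10)) (c_seq (c_dir (r_frac 17 10)) (c_dir (r_frac 18 10))))
    (c_for iK iN
      (c_seq (c_dir (r_add (r_frac 3 2) e_shift2)) (c_dir (r_add (r_frac 31 20) e_shift2)))).

Ltac solve_frac := first [apply reval_frac; lia | apply reval_const].

Lemma shift1_bounds k : (k < N)%nat -> - (1 / 26) <= shift1 (Y k) <= 1 / 240.
Proof. intros H. specialize (Y_range k H). unfold shift1. destruct Rlt_dec; lra. Qed.

Lemma shift2_bounds k : (k < N)%nat -> - (1 / 240) <= shift2 (Y k) <= 1 / 48.
Proof. intros H. specialize (Y_range k H). unfold shift2. destruct Rlt_dec; lra. Qed.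

Lemma reval_gap s : ready s -> reval s (r_var rGap) = Some w.
Proof. intros (_ & _ & <- & _). reflexivity. Qed.

Lemma reval_shift1 s k : ready s -> ireg s iK = k -> (k < N)%nat ->
  reval s e_shift1 = Some (shift1 (Y k)).
Proof. intros (_ & _ & _ & H) <- Hk. rewrite <- (proj1 (H _ Hk)). reflexivity. Qed.

Lemma reval_shift2 s k : ready s -> ireg s iK = k -> (k < N)%nat ->
  reval s e_shift2 = Some (shift2 (Y k)).
Proof. intros (_ & _ & _ & H) <- Hk. rewrite <- (proj2 (H _ Hk)). reflexivity. Qed.

Lemma reval_shift2_rev s k : ready s -> ireg s iK = k -> (k < N)%nat ->
  reval s e_shift2_rev = Some (shift2 (Y (N - 1 - k))).
Proof.
  intros (E & _ & _ & H) <- Hk. rewrite <- (proj2 (H (N - 1 - ireg s iK)%nat ltac:(lia))).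
  simpl. rewrite E. reflexivity.
Qed.

Lemma emits_positions s : ready s ->
  emits O [iK; iLen] c_positions s (100 * (N + 1) + 60)
    (coordinates (map dir (flat_map (fun t => [t; t + w]) (positions L)))).
Proof.
  intros Hr. eapply emits_weaken.
  - eapply (emits_cat [iK; iLen]); [exact Hr|apply incl_refl| |].
    + eapply (emits_cat [iK; iLen]); [exact Hr|apply incl_refl| |].
      * eapply emits_single; [assumption|reflexivity|intros; solve_frac|simpl; lra].
      * intros s' Hr' _. eapply emits_single; [assumption|reflexivity| |].
        -- intros. apply reval_add; [solve_frac|apply reval_gap; assumption].
        -- simpl; lra.
    + intros s' Hr' _.
      apply (emits_loop iN N _ 70 (fun k => [dir (3 / 2 + shift1 (Y k)); dir (3 / 2 + shift1 (Y k) + w)]));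
        [assumption|lia|lia|apply Hr'|].
      intros k s1 Hk Hr1 E. pose proof (shift1_bounds k Hk).
      eapply emits_weaken.
      * eapply (emits_cat [iLen]); [exact Hr1|exact (fun x h => or_intror h)| |].
        -- eapply emits_dir; [assumption|exact E| |].
           ++ intros. apply reval_add; [solve_frac|eapply reval_shift1; eassumption].
           ++ simpl; lra.
        -- intros s2 Hr2 E2. eapply emits_dir; [assumption| | |].
           ++ rewrite E2; [exact E|simpl; lia].
           ++ intros. apply reval_add; [apply reval_add; [solve_frac|eapply reval_shift1; eassumption]|].
              apply reval_gap; assumption.
           ++ simpl; lra.
      * apply incl_refl.
      * simpl; lia.
      * reflexivity.
  - apply incl_refl.
  - simpl; lia.
  - unfold positions, L. f_equal. cbn [flat_map]. rewrite map_app. f_equal.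
    rewrite map_map, map_flat_map, flat_map_of_map. reflexivity.
Qed.

Lemma emits_sums s : ready s ->
  emits O [iK; iLen] c_sums s (100 * (N + 1) + 100)
    (coordinates (map dir (sum_angles L))).
Proof.
  intros Hr.
  assert (Hloop : forall s' e c, ready s' -> (rcost e <= 5)%nat -> 3 <= c <= 61 / 20 ->
    (forall s, reval s e = Some c) ->
    emits O [iK; iLen] (c_for iK iN (c_dir (r_sub e e_shift2_rev))) s' ((N + 1) * (40 + 8))
      (coordinates (flat_map (fun k => [dir (c - shift2 (Y (N - 1 - k)))]) (seq 0 N)))).
  { intros s' e c Hr' Hcost Hc He. apply emits_loop; [assumption|lia|lia|apply Hr'|].
    intros k s1 Hk Hr1 E. pose proof (shift2_bounds (N - 1 - k) ltac:(lia)).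
    eapply emits_weaken; [eapply emits_dir; [assumption|exact E| |]|apply incl_refl| |reflexivity].
    - intros. apply reval_sub; [apply He|eapply reval_shift2_rev; eassumption].
    - lra.
    - simpl. lia. }
  eapply emits_weaken.
  - eapply (emits_cat [iK; iLen]); [exact Hr|apply incl_refl| |].
    + eapply (emits_cat [iK; iLen]); [exact Hr|apply incl_refl| |
        intros s' Hr' _; eapply (emits_cat [iK; iLen]); [exact Hr'|apply incl_refl| |]].
      * eapply emits_single; [assumption|reflexivity|intros; solve_frac|simpl; lra].
      * eapply emits_single; [assumption|reflexivity|intros; solve_frac|simpl; lra].
      * intros s2 Hr2 _.
        eapply emits_single; [assumption|reflexivity|intros; solve_frac|simpl; lra].
    + intros s' Hr' _. eapply (emits_cat [iK; iLen]); [exact Hr'|apply incl_refl| |].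
      * apply (Hloop _ _ 3); [assumption|simpl; lia|lra|intros; apply reval_const].
      * intros s2 Hr2 _. apply (Hloop _ _ (61 / 20)); [assumption|simpl; lia|lra|].
        intros; apply reval_frac; lia.
  - apply incl_refl.
  - simpl; lia.
  - unfold sum_angles, L. f_equal. rewrite !map_app, <- !map_rev, !map_map, rev_seq_0, !map_map.
    rewrite <- !map_as_flat_map. reflexivity.
Qed.

Lemma emits_points s : ready s ->
  emits O [iK; iLen] c_points s (100 * (N + 1) + 100)
    (coordinates (map dir (point_angles L))).
Proof.
  intros Hr. eapply emits_weaken.
  - eapply (emits_cat [iK; iLen]); [exact Hr|apply incl_refl| |].
    + eapply (emits_cat [iK; iLen]); [exact Hr|apply incl_refl| |
        intros s' Hr' _; eapply (emits_cat [iK; iLen]); [exact Hr'|apply incl_refl| |]].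
      * eapply emits_single; [assumption|reflexivity|intros; solve_frac|simpl; lra].
      * eapply emits_single; [assumption|reflexivity|intros; solve_frac|simpl; lra].
      * intros s2 Hr2 _.
        eapply emits_single; [assumption|reflexivity|intros; solve_frac|simpl; lra].
    + intros s' Hr' _.
      apply (emits_loop iN N _ 70 (fun k => [dir (3 / 2 + shift2 (Y k)); dir (31 / 20 + shift2 (Y k))]));
        [assumption|lia|lia|apply Hr'|].
      intros k s1 Hk Hr1 E. pose proof (shift2_bounds k Hk).
      eapply emits_weaken.
      * eapply (emits_cat [iLen]); [exact Hr1|exact (fun x h => or_intror h)| |].
        -- eapply emits_dir; [assumption|exact E| |].
           ++ intros. apply reval_add; [solve_frac|eapply reval_shift2; eassumption].
           ++ simpl; lra.
        -- intros s2 Hr2 E2. eapply emits_dir; [assumption| | |].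
           ++ rewrite E2; [exact E|simpl; lia].
           ++ intros. apply reval_add; [solve_frac|eapply reval_shift2; eassumption].
           ++ simpl; lra.
      * apply incl_refl.
      * simpl; lia.
      * reflexivity.
  - apply incl_refl.
  - simpl; lia.
  - unfold point_angles, L. f_equal. rewrite map_app. simpl map at 2. cbn [app]. f_equal.
    f_equal. f_equal.
    rewrite map_flat_map, flat_map_of_map. reflexivity.
Qed.

Lemma emits_chord s k e t : ready s -> ireg s iK = k -> (rcost e <= 20)%nat ->
  (forall s', ready s' -> ireg s' iK = k -> reval s' e = Some t) ->
  emits O [iLen] (c_chord e) s 150 (coordinates [chord_point w t]).
Proof.
  intros Hr E Hcost He. pose proof pi_gt_3.
  eapply emits_weaken; [apply emits_push_point|apply incl_refl|simpl; lia|reflexivity].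
  intros s' F. apply frame_len in F as [F E'].
  pose proof (ready_frame _ _ Hr F) as Hr'.
  assert (He' : reval s' e = Some t) by (apply He; [assumption|congruence]).
  split; (apply reval_add; apply reval_mul;
    [apply reval_sub; [solve_frac|assumption]| |assumption|]).
  - apply reval_cos; [solve_frac|simpl; lra].
  - apply reval_cos; [apply reval_gap; assumption|lra].
  - apply reval_sin; [solve_frac|simpl; lra].
  - apply reval_sin; [apply reval_gap; assumption|lra].
Qed.

Lemma emits_chords s : ready s ->
  emits O [iK; iLen] c_chords s (400 * (W + 1))
    (coordinates (map (chord_point w) (low_params W) ++ map (chord_point w) (high_params W))).
Proof.
  intros Hr.
  assert (Hlow : forall k s', ready s' -> ireg s' iK = k ->
    reval s' e_low = Some (INR (S k) / (5 * INR W))).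
  { intros k s' (_ & E & _) <-. apply reval_div.
    - simpl. rewrite Nat.add_1_r. reflexivity.
    - apply reval_mul; [solve_frac|]. simpl. rewrite E. reflexivity.
    - assert (0 < INR W) by (apply lt_0_INR; unfold W; lia). lra. }
  eapply emits_weaken.
  - eapply (emits_cat [iK; iLen]); [exact Hr|apply incl_refl| |].
    + apply (emits_loop iWeight W _ 150 (fun k => [chord_point w (INR (S k) / (5 * INR W))]));
        [assumption|lia|lia|apply Hr|].
      intros k s1 Hk Hr1 E. apply (emits_chord _ k); [assumption|assumption|simpl; lia|].
      apply Hlow.
    + intros s' Hr' _.
      apply (emits_loop iWeight W _ 150 (fun k => [chord_point w (1 - INR (S k) / (5 * INR W))]));
        [assumption|lia|lia|apply Hr'|].
      intros k s1 Hk Hr1 E. apply (emits_chord _ k); [assumption|assumption|simpl; lia|].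
      intros. apply reval_sub; [solve_frac|apply Hlow; assumption].
  - apply incl_refl.
  - lia.
  - unfold low_params, high_params. rewrite !map_map, <- !map_as_flat_map. reflexivity.
Qed.

Definition c_header : cmd :=
  c_seq (c_push (r_nat (i_add (i_add (i_add (i_var iN) (i_var iN))
                                     (i_add (i_var iN) (i_var iN))) (i_const 5))))
    (c_seq (c_push (r_nat (i_add (i_add (i_var iWeight) (i_var iWeight)) (i_var iWeight))))
      (c_seq (c_push (r_nat (i_const 0))) (c_push (r_nat (i_const 0))))).

Definition c_instance : cmd :=
  c_seq (c_seq (c_iset iLen (i_const 0))
               (c_iset iWeight (i_add (i_add (i_var iN) (i_var iN)) (i_const 3))))
    (c_seq c_header (c_seq (c_seq c_positions c_sums) (c_seq c_chords c_points))).

Lemma point_angles_weight : length (point_angles L) = W.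
Proof. rewrite point_angles_length. unfold L. rewrite length_map, length_seq. reflexivity. Qed.

Lemma emits_header s : ready s ->
  emits O [iK; iLen] c_header s 64
    [INR (length (gadget_region L w)); INR (length (gadget_points L w)); 0; 0].
Proof.
  intros Hr. rewrite gadget_region_length, gadget_points_length, point_angles_weight.
  unfold L. rewrite length_map, length_seq.
  assert (Hpush : forall s e v, (rcost e <= 10)%nat -> reval s e = Some v ->
            emits O [iK; iLen] (c_push e) s 16 [v]).
  { intros s' e v Hc E. eapply emits_weaken; [exact (emits_push O s' e v E)| |lia|reflexivity].
    intros x Hx; right; assumption. }
  eapply emits_weaken.
  - eapply emits_seq.
    + apply Hpush; [simpl; lia|]. simpl. rewrite (proj1 Hr). reflexivity.
    + intros s1 F1. pose proof (ready_frame _ _ Hr F1) as Hr1. eapply emits_seq.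
      * apply Hpush; [simpl; lia|]. simpl. rewrite (proj1 (proj2 Hr1)). reflexivity.
      * intros s2 F2. eapply emits_seq.
        -- apply Hpush; [simpl; lia|apply reval_const].
        -- intros s3 F3. apply Hpush; [simpl; lia|apply reval_const].
  - apply incl_refl.
  - lia.
  - reflexivity.
Qed.

(** [I] is given through its data fields because the encoding does not see the proofs stored in an
    instance. *)
Lemma runs_instance s I :
  ireg s iN = N -> rreg s rGap = w ->
  (forall k, (k < N)%nat ->
    rarr s aShift1 k = shift1 (Y k) /\ rarr s aShift2 k = shift2 (Y k)) ->
  center I = (0, 0) -> region I = gadget_region L w -> points I = gadget_points L w ->
  runs O c_instance s (3000 * (N + 1)) (fun s' => fetch s' aBuffer iLen = encode fixed_mcr I).
Proof.
  intros E1 E2 E3 Ec Er Ep. eapply runs_weaken.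
  - apply runs_seq, runs_wp. simpl.
    set (s0 := set_ireg _ iWeight _).
    assert (Hr : ready s0).
    { unfold ready, s0, W. st. rewrite E1. split; [reflexivity|]. auto. }
    assert (H0 : fetch s0 aBuffer iLen = []) by reflexivity.
    clearbody s0.
    assert (He : emits O [iK; iLen]
      (c_seq c_header (c_seq (c_seq c_positions c_sums) (c_seq c_chords c_points))) s0
      (2900 * (N + 1)) (encode fixed_mcr I)).
    2: { eapply runs_weaken; [exact He|apply le_n|]. cbv beta. intros s' [_ E].
         rewrite H0 in E. exact E. }
    eapply emits_weaken.
    + apply emits_seq; [apply emits_header, Hr|].
      intros s1 F1. pose proof (ready_frame _ _ Hr F1) as Hr1.
      eapply (emits_cat [iK; iLen]); [exact Hr1|apply incl_refl| |].
      * eapply (emits_cat [iK; iLen]); [exact Hr1|apply incl_refl|apply emits_positions, Hr1|].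
        intros s2 Hr2 _. apply emits_sums, Hr2.
      * intros s2 Hr2 _.
        eapply (emits_cat [iK; iLen]); [exact Hr2|apply incl_refl|apply emits_chords, Hr2|].
        intros s3 Hr3 _. apply emits_points, Hr3.
    + apply incl_refl.
    + unfold W. lia.
    + cbn [encode fixed_mcr]. rewrite Ec, Er, Ep. cbn [fst snd app]. do 4 f_equal.
      unfold coordinates. f_equal.
      unfold gadget_region, vertex_angles, gadget_points.
      rewrite point_angles_weight, map_app, !app_assoc. reflexivity.
  - simpl. lia.
  - auto.
Qed.

End Emission.

(** * The reduction *)

Definition c_prepare : cmd :=
  c_seq c_bound (c_seq c_root (c_seq c_fill (c_seq c_minima
    (c_seq c_select (c_seq c_shift c_instance))))).

(** The oracle leaves the angle in cell 0 of [aBuffer]; the answer must go to array 0, with length 1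
    in register 0. *)
Definition c_finish : cmd :=
  c_seq
    (c_if (b_ltr (r_get aBuffer (i_const 0)) (r_frac 5 4))
       (c_rput aInput (i_const 0) (r_nat (i_const 0)))
       (c_rput aInput (i_const 0) (r_nat (i_const 1))))
    (c_iset iN (i_const 1)).

Definition reduction : cmd := c_seq c_prepare (c_seq (c_call aBuffer iLen) c_finish).

Definition time (N : nat) : nat := (5000 * ((N + 1) * (Nat.sqrt_up N + 1)))%nat.

Lemma zero_triple_scale (l m : list R) c : 0 < c ->
  (forall y, In y m <-> exists x, In x l /\ y = x / c) ->
  has_zero_triple l <-> has_zero_triple m.
Proof.
  intros Hc Hm.
  assert (Hneq : forall x y, x <> y <-> x / c <> y / c).
  { intros x y. split; intros H E; apply H; [apply Rdiv_eq_reg_r in E; lra|congruence]. }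
  assert (Hsum : forall x y z, x + y + z = 0 <-> x / c + y / c + z / c = 0).
  { intros x y z. replace (x / c + y / c + z / c) with ((x + y + z) / c) by (field; lra).
    split; intros E; [rewrite E; field; lra|].
    apply (Rmult_eq_compat_r c) in E. field_simplify in E; lra. }
  split.
  - intros (x & y & z & Hx & Hy & Hz & Hxy & Hxz & Hyz & E).
    exists (x / c), (y / c), (z / c).
    rewrite <- !Hneq, <- Hsum. repeat split; try assumption; apply Hm; eauto.
  - intros (x & y & z & Hx & Hy & Hz & Hxy & Hxz & Hyz & E).
    apply Hm in Hx as (x' & Hx & ->), Hy as (y' & Hy & ->), Hz as (z' & Hz & ->).
    exists x', y', z'. rewrite <- !Hneq in *. rewrite <- Hsum in E. tauto.
Qed.

Lemma runs_prepare O l : NoDup l ->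
  runs O c_prepare (store blank aInput iN l)
    (4900 * ((length l + 1) * (Nat.sqrt_up (length l) + 1))) (fun s =>
    exists L w (Hw : 0 < w <= 1 / 480)
      (Hs : StronglySorted (fun u v => u + 3 * w <= v) L)
      (Hr : forall y, In y L -> - (1 / 240) <= y <= 1 / 240),
      fetch s aBuffer iLen = encode fixed_mcr (gadget L w Hw Hs Hr) /\
      length L = length l /\ (has_zero_triple l <-> has_zero_triple L)).
Proof.
  intros Hl. set (N := length l). set (q := Nat.sqrt_up N).
  assert (Hq : (q <= N)%nat) by apply Nat.sqrt_up_le_lin, Nat.le_0_l.
  assert (HNq : (N <= q * q)%nat).
  { destruct (Nat.eq_dec N 0) as [E|E]; [lia|].
    apply (Nat.sqrt_up_spec N); lia. }
  set (s0 := store blank aInput iN l). set (X := rarr s0 aInput).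
  assert (HX : forall i, X i = nth i l 0) by reflexivity.
  assert (HN : ireg s0 iN = N) by reflexivity.
  assert (X_inj : forall i j, (i < N)%nat -> (j < N)%nat -> X i = X j -> i = j).
  { intros i j Hi Hj. rewrite !HX. apply NoDup_nth; assumption. }
  clearbody s0.
  (* Every phase is charged to multiples of [B]: the budgets that follow drop by at least the cost
     of the phase just run, and the linear phases at the end fit into what remains. *)
  set (B := ((N + 1) * (q + 1))%nat).
  assert (HB1 : (N + 1 <= B)%nat) by (unfold B; nia).
  assert (HB2 : ((q + 1) * (q + 1) <= B)%nat) by (unfold B; nia).
  assert (HB3 : (q + 1 <= B)%nat) by (unfold B; nia).
  apply (runs_then _ _ _ _ _ (4800 * B) _ _ _ (runs_bound O s0)); [|lia].
  rewrite HN. fold X. intros s1 (A1 & A2 & M_pos & X_bound).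
  set (M := rreg s1 rBound) in *.
  apply (runs_then _ _ _ _ _ (4700 * B) _ _ _ (runs_root O s1)); [|rewrite A1; fold q; lia].
  rewrite A1, A2. fold q. intros s2 (B1 & B2 & B3 & B4).
  apply (runs_then _ _ _ _ _ (4600 * B) _ _ _
    (runs_fill O N q X M M_pos HNq s2 B2 B1 B3 B4)); [|lia].
  intros s3 HP.
  apply (runs_then _ _ _ _ _ (4500 * B) _ _ _ (runs_minima O N q X M HNq s3 HP)); [|lia].
  intros s4 (HP' & Hlast & Hmin).
  apply (runs_then _ _ _ _ _ (4300 * B) _ _ _
    (runs_select O N q X M M_pos X_bound X_inj HNq s4 HP' Hlast Hmin)); [|fold B; lia].
  cbv zeta. intros s5 (E5 & Hw & Hs & Hmem).
  set (L := map (rarr s5 aSorted) (seq 0 N)) in *.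
  assert (Hr : forall y, In y L -> - (1 / 240) <= y <= 1 / 240).
  { intros y Hy. apply Hmem in Hy as (p & Hp & ->). apply value_range; assumption. }
  apply (runs_then _ _ _ _ _ (3000 * (N + 1)) _ _ _ (runs_shift O s5)); [|lia].
  rewrite E5. intros s6 (E6 & E7 & Hsh).
  eapply runs_weaken; [|apply le_n|].
  - apply (runs_instance O N (rarr s5 aSorted) (rreg s5 rGap) Hw) with
      (I := gadget L (rreg s5 rGap) Hw Hs Hr); try assumption; try reflexivity.
    intros k Hk. apply Hr, in_map, in_seq. lia.
  - cbv beta. intros s7 E8. exists L, (rreg s5 rGap), Hw, Hs, Hr.
    split; [exact E8|]. split.
    + unfold L. rewrite length_map, length_seq. reflexivity.
    + apply (zero_triple_scale _ _ (240 * M)); [lra|].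
      intros y. rewrite Hmem. split.
      * intros (p & Hp & ->). exists (X p). split.
        -- rewrite HX. apply nth_In. exact Hp.
        -- unfold value. apply Nat.ltb_lt in Hp. rewrite Hp. reflexivity.
      * intros (x & Hx & ->). destruct (In_nth _ _ 0 Hx) as (p & Hp & <-).
        exists p. split; [exact Hp|]. unfold value. fold N in Hp.
        apply Nat.ltb_lt in Hp. rewrite Hp, HX. reflexivity.
Qed.

Lemma time_subquadratic : subquadratic time.
Proof.
  intros eps Heps.
  (* With [r] the predecessor of the rounded-up root, the time is at most
     [5000 * (2 * N) * (3 * r) = 30000 * N * r]. From [r * r <= N] and [eps * r >= 30000] follows
     [30000 * r <= eps * N]. *)
  destruct (INR_unbounded (30000 / eps)) as (r0 & Hr0).
  exists ((r0 + 1) * (r0 + 1) + 1)%nat. intros N HN. unfold time.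
  set (q := Nat.sqrt_up N).
  assert (Hq : (Nat.pred q * Nat.pred q < N <= q * q)%nat)
    by (apply Nat.sqrt_up_spec; lia).
  assert (Hr : (r0 + 1 <= Nat.pred q)%nat) by nia.
  set (r := Nat.pred q) in *. replace (q + 1)%nat with (r + 2)%nat by lia.
  assert (Hb : ((N + 1) * (r + 2) <= (2 * N) * (3 * r))%nat)
    by (apply Nat.mul_le_mono; lia).
  apply le_INR in Hb. rewrite mult_INR.
  replace (INR 5000) with 5000 by (rewrite INR_IZR_INZ; reflexivity).
  rewrite (mult_INR (2 * N)), (mult_INR 2), (mult_INR 3) in Hb. simpl (INR 2) in Hb.
  simpl (INR 3) in Hb.
  assert (H1 : 30000 <= eps * INR r).
  { apply (Rmult_lt_compat_l eps) in Hr0; [|assumption].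
    replace (eps * (30000 / eps)) with 30000 in Hr0 by (field; lra).
    assert (INR r0 <= INR r) by (apply le_INR; lia). nra. }
  assert (H2 : INR r * INR r <= INR N) by (rewrite <- mult_INR; apply le_INR; lia).
  assert (H3 : 0 <= INR r) by apply pos_INR.
  assert (H4 : 0 <= INR N) by apply pos_INR.
  assert (H5 : 30000 * INR r <= eps * INR N).
  { apply Rle_trans with (eps * (INR r * INR r)); [|apply Rmult_le_compat_l; lra].
    rewrite <- Rmult_assoc. apply Rmult_le_compat_r; assumption. }
  apply (Rmult_le_compat_r (INR N)) in H5; [|assumption].
  replace (INR N ^ 2) with (INR N * INR N) by ring. lra.
Qed.

Theorem theorem4 : three_sum_hard fixed_mcr.
Proof.
  (* One call suffices; the instance has [4 * N + 5] vertices and [6 * N + 9] points, [10 * N + 14]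
     in all. *)
  exists reduction, 1%nat, 14%nat, time. split; [exact time_subquadratic|].
  intros O HO X N. unfold N; simpl size. set (l := numbers X).
  destruct (runs_prepare O l (numbers_distinct X)) as
    (s & t & Hexec & Ht & L & w & Hw & Hs & Hr & Hf & HL & Hiff).
  set (I := gadget L w Hw Hs Hr) in *.
  destruct (HO I) as (theta & Eout & Htheta & Hmax).
  pose proof (gadget_answer L w Hw Hs Hr theta Htheta Hmax) as Hans.
  rewrite <- Hiff in Hans.
  set (s' := store s aBuffer iLen (O (fetch s aBuffer iLen))).
  assert (Hfin : runs O c_finish s' 40 (fun s'' =>
    fetch s'' 0 0 = [if Rlt_dec theta (5 / 4) then 0 else 1])).
  { apply runs_wp_le; [|simpl; lia]. cbn [wp].
    eexists; split; [apply beval_ltr; [reflexivity|apply reval_frac; lia]|].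
    assert (Eth : rarr s' aBuffer (ieval s' (i_const 0)) = theta).
    { unfold s'. rewrite Hf, Eout. reflexivity. }
    rewrite Eth. simpl Z.of_nat.
    destruct (Rlt_dec theta (5 / 4)); (eexists; split; [apply reval_const|reflexivity]). }
  destruct Hfin as (s'' & u & Hexec' & Hu & Hout).
  exists (fetch s'' 0 0), (t + (1 + u))%nat, ([] ++ [fetch s aBuffer iLen] ++ []).
  repeat split.
  - exists s''. split; [|reflexivity].
    apply (exec_seq O _ s); [exact Hexec|]. apply (exec_seq O _ s'); [|exact Hexec'].
    apply exec_call.
  - simpl. rewrite Hout. fold l. destruct Rlt_dec as [H|H]; [right|left]; (split; [|reflexivity]).
    + rewrite Hans. lra.
    + apply Hans. lra.
  - unfold time. nia.
  - simpl. lia.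
  - simpl. constructor; [|constructor]. exists I. split; [exact Hf|].
    change (length (gadget_points L w) + length (gadget_region L w) <= 14 * (length l + 1))%nat.
    rewrite gadget_points_length, gadget_region_length, point_angles_length, HL.
    lia.
Qed.
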